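(* Let $f:\mathbb{R}^n\to\mathbb{R}$ and the stochastic estimators $G_\delta$, $H$ satisfy Assumptions A and B (stated in the context) with constants $f_{\mathrm{low}},L,L_F,\sigma,L_H$. Define $$M_{\mathrm{rm}}:=75\Big(f(x^0)-f_{\mathrm{low}}+\sigma^3(L_F^3+L_H^3)^{-2/3}+(L_F^3+L_H^3)\sigma^3+1\Big).$$ For a positive integer $K$, let $\{x^k\}$ be all iterates generated by the SCRN method with recursive momentum (described in the context) started at $x^0\in\mathbb{R}^n$ with input parameters $$\eta_k=\frac{1}{17K^{1/5}},\qquad \theta_k=\frac{625(L_F^3+L_H^3)^{2/3}}{289K^{2/5}},\qquad \delta_k=\frac{1}{17K^{3/5}}\qquad\forall k\ge0,$$ and let $\iota_K$ be uniformly drawn from $\{1,\ldots,K\}$. Then, for any $\epsilon_g,\epsilon_H\in(0,1)$, $x^{\iota_K}$ is an $(\epsilon_g,\epsilon_H)$-stochastic second-order stationary point of $\min_{x\in\mathbb{R}^n}f(x)$, that is, $$\mathbb{E}[\|\nabla f(x^{\iota_K})\|^{3/2}]\le\epsilon_g^{3/2}\quad\text{and}\quad \mathbb{E}[\lambda_{\min}(\nabla^2f(x^{\iota_K}))^3]\ge-\epsilon_H^3,$$ for all $K$ satisfying $$K\ge\max\Big\{\Big(\frac{(3M_{\mathrm{rm}})^{2/3}}{\epsilon_g}\Big)^{5/3},\Big(\frac{(281M_{\mathrm{rm}})^{1/3}}{\epsilon_H}\Big)^{5},\Big(\frac{2L}{17}\Big)^{5},7(L_F^3+L_H^3)^{5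/3},1\Big\}.$$
   Context: Notation: $\|\cdot\|$ is the Euclidean norm for vectors and the spectral norm for matrices; $\|\cdot\|_F$ is the Frobenius norm; $\lambda_{\min}$ is the minimum eigenvalue. Throughout, $f:\mathbb{R}^n\to\mathbb{R}$ is twice continuously differentiable and $\min_{x\in\mathbb{R}^n}f(x)$ has at least one optimal solution. Assumption A. (a) There is a finite $f_{\mathrm{low}}$ with $f(x)\ge f_{\mathrm{low}}$ for all $x\in\mathbb{R}^n$. (b) There exist $L>0$ and $L_F>0$ with $\|\nabla^2f(y)-\nabla^2f(x)\|\le L\|y-x\|$ and $\|\nabla^2f(y)-\nabla^2f(x)\|_F\le L_F\|y-x\|$ for all $x,y\in\mathbb{R}^n$. (c) For any $\delta\in(0,1)$ there is a stochastic gradient estimator $G_\delta:\mathbb{R}^n\times\mathcal{Z}\to\mathbb{R}^n$ with $\mathbb{E}_\zeta[\|G_\delta(x;\zeta)-\nabla f(x)\|^{3/2}]\le\delta^{3/2}$ for all $x\in\mathbb{R}^n$. (d) There is a stochastic Hessian estimator $H:\mathbb{R}^n\times\Xi\to\mathbb{R}^{n\times n}$ and $\sigma>0$ with $\mathbb{E}_\xi[H(x;\xi)]=\nabla^2f(x)$ and $\mathbb{E}_\xi[\|H(x;\xi)-\nabla^2f(x)\|_F^3]\le\sigma^3$ for all $x\in\mathbb{R}^n$. Assumption B (mean-cubed smoothness). There exists $L_H>0$ with $\mathbb{E}_\xi[\|H(y;\xi)-H(x;\xi)\|_F^3]\le L_H^3\|y-x\|^3$ for all $x,y\in\mathbb{R}^n$.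 SCRN method with recursive momentum. Input: starting point $x^0\in\mathbb{R}^n$, regularization parameters $\{\eta_k\}\subset(0,\infty)$, error control parameters $\{\delta_k\}\subset(0,1)$, momentum parameters $\{\theta_k\}\subset(0,1)$. Initialize $M_{-1}=0$, $\theta_{-1}=1$ (so the terms with coefficient $1-\theta_{-1}=0$ vanish and $M_0=H(x^0;\xi^0)$). For $k=0,1,2,\ldots$: draw fresh samples $\zeta^k$, $\xi^k$ (independent of all earlier randomness) and set $$g^k=G_{\delta_k}(x^k;\zeta^k),\qquad M_k=(1-\theta_{k-1})M_{k-1}+H(x^k;\xi^k)-(1-\theta_{k-1})H(x^{k-1};\xi^k),$$ and choose $$x^{k+1}\in\mathop{\mathrm{Arg\,min}}_{x\in\mathbb{R}^n}\Big\{(g^k)^T(x-x^k)+\tfrac12(x-x^k)^TM_k(x-x^k)+\tfrac{1}{6\eta_k}\|x-x^k\|^3\Big\}.$$ The index $\iota_K$ is drawn independently of the algorithm's randomness, and $\mathbb{E}$ is expectation over all randomness (samples and $\iota_K$). *)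

(* Defs.v *)
From HB Require Import structures.
From mathcomp Require Import all_boot all_order all_algebra.
From mathcomp Require Import all_classical all_reals all_analysis.

Set Implicit Arguments.
Unset Strict Implicit.
Unset Printing Implicit Defensive.

Import Order.TTheory GRing.Theory Num.Theory.
Import numFieldNormedType.Exports.

Local Open Scope classical_set_scope.
Local Open Scope ring_scope.

(* Vectors of R^n are column vectors 'cV[R]_n. The library's norm `|_| on
   matrices is the max-norm; it is used here only through the topology and the
   differential structure it induces, which do not depend on the norm. *)

Section Norms.
Context {R : realType}.

Definition euclid_norm n (v : 'cV[R]_n) : R :=
  Num.sqrt (\sum_(i < n) v i 0 ^+ 2).

Definition frob_norm m n (A : 'M[R]_(m, n)) : R :=
  Num.sqrt (\sum_(i < m) \sum_(j < n) A i j ^+ 2).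

(* The matrix norm induced by the Euclidean norm. *)
Definition spectral_norm m n (A : 'M[R]_(m, n)) : R :=
  sup [set euclid_norm (A *m v) | v in [set v | euclid_norm v <= 1]].

(* For a symmetric A with 0 < n the set is finite and nonempty, so that the
   infimum is a minimum. *)
Definition lambda_min n (A : 'M[R]_n) : R :=
  inf [set a | eigenvalue A a].

End Norms.

Section Derivatives.
Context {R : realType} {n : nat}.

Definition grad (f : 'cV[R]_n -> R) (x : 'cV[R]_n) : 'cV[R]_n :=
  \col_i 'D_(delta_mx i 0) f x.

Definition hess (f : 'cV[R]_n -> R) (x : 'cV[R]_n) : 'M[R]_n :=
  \matrix_(i, j) 'D_(delta_mx j 0) (fun y => grad f y i 0) x.

Definition twice_cont_diff (f : 'cV[R]_n -> R) : Prop :=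
  [/\ forall x, differentiable f x,
      forall x, differentiable (grad f) x
    & continuous (hess f)].

End Derivatives.

(* Borel sigma-algebra on vectors and matrices. *)
HB.instance Definition _ (R : realType) (m n : nat) :=
  @isMeasurable.Build (sigma_display (@open 'M[R]_(m, n))) 'M[R]_(m, n)
    <<s @open 'M[R]_(m, n) >>
    (@sigma_algebra0 _ setT (@open 'M[R]_(m, n)))
    (@sigma_algebraC _ (@open 'M[R]_(m, n)))
    (@sigma_algebra_bigcup _ setT (@open 'M[R]_(m, n))).

Section Assumptions.
Context {R : realType} {n : nat}.
Context {dZ dXi : measure_display}.
Context {Z : measurableType dZ} {Xi : measurableType dXi}.
Variables (PZ : probability Z R) (PXi : probability Xi R).
Local Open Scope ereal_scope.

(* PZ and PXi are the laws of the samples zeta and xi. The joint measurability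
   fields make explicit that a stochastic estimator is a measurable function of
   the query point and of the sample. The equation for the mean of H is
   entrywise and forces each mean to be finite. *)
Record assumptionA (f : 'cV[R]_n -> R) (G : R -> 'cV[R]_n -> Z -> 'cV[R]_n)
    (H : 'cV[R]_n -> Xi -> 'M[R]_n) (f_low L L_F sigma : R) : Prop := {
  A_lower_bound : forall x, (f_low <= f x)%R;
  A_L_gt0 : (0 < L)%R;
  A_L_F_gt0 : (0 < L_F)%R;
  A_hess_lip : forall x y,
    (spectral_norm (hess f y - hess f x) <= L * euclid_norm (y - x))%R;
  A_hess_lip_frob : forall x y,
    (frob_norm (hess f y - hess f x) <= L_F * euclid_norm (y - x))%R;
  A_G_measurable : forall delta : R, (0 < delta < 1)%R ->
    measurable_fun [set: 'cV[R]_n * Z] (fun p => G delta p.1 p.2);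
  A_G_error : forall delta : R, (0 < delta < 1)%R -> forall x,
    'E_PZ[(fun z => euclid_norm (G delta x z - grad f x) `^ (3 / 2))%R]
      <= (delta `^ (3 / 2))%R%:E;
  A_sigma_gt0 : (0 < sigma)%R;
  A_H_measurable :
    measurable_fun [set: 'cV[R]_n * Xi] (fun p => H p.1 p.2);
  A_H_unbiased : forall x i j,
    'E_PXi[fun xi => H x xi i j] = (hess f x i j)%:E;
  A_H_error : forall x,
    'E_PXi[(fun xi => frob_norm (H x xi - hess f x) ^+ 3)%R]
      <= (sigma ^+ 3)%R%:E
}.

Record assumptionB (H : 'cV[R]_n -> Xi -> 'M[R]_n) (L_H : R) : Prop := {
  B_L_H_gt0 : (0 < L_H)%R;
  B_mean_cubed_smooth : forall x y,
    'E_PXi[(fun xi => frob_norm (H y xi - H x xi) ^+ 3)%R]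
      <= (L_H ^+ 3 * euclid_norm (y - x) ^+ 3)%R%:E
}.

End Assumptions.

Section Algorithm.
Context {R : realType} {n : nat}.
Context {dZ dXi dO : measure_display}.
Context {Z : measurableType dZ} {Xi : measurableType dXi}.
Context {Omega : measurableType dO}.

Definition cubic_model (g : 'cV[R]_n) (M : 'M[R]_n) (eta : R)
    (x y : 'cV[R]_n) : R :=
  (g^T *m (y - x)) 0 0 + 2^-1 * ((y - x)^T *m M *m (y - x)) 0 0
  + (6 * eta)^-1 * euclid_norm (y - x) ^+ 3.

(* The conventions M_{-1} = 0 and theta_{-1} = 1 reduce the recursion at k = 0
   to M_0 = H(x^0; xi^0). *)
Fixpoint momentum_hess (H : 'cV[R]_n -> Xi -> 'M[R]_n) (theta : nat -> R)
    (x : nat -> Omega -> 'cV[R]_n) (xi : nat -> Omega -> Xi)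
    (k : nat) (w : Omega) : 'M[R]_n :=
  if k is k'.+1 then
    (1 - theta k') *: momentum_hess H theta x xi k' w
    + H (x k'.+1 w) (xi k'.+1 w)
    - (1 - theta k') *: H (x k' w) (xi k'.+1 w)
  else H (x 0 w) (xi 0 w).

(* Events determined by all that happens before the samples zeta^k, xi^k are
   drawn: the earlier samples and the iterates x^0, ..., x^k. The iterates are
   listed because the selection of a minimizer may itself be randomized. *)
Definition history (x : nat -> Omega -> 'cV[R]_n) (zeta : nat -> Omega -> Z)
    (xi : nat -> Omega -> Xi) (k : nat) : set (set Omega) :=
  <<s (\bigcup_(j in [set j | (j <= k)%N])
         preimage_set_system setT (x j) measurable)
      `|` (\bigcup_(j in [set j | (j < k)%N])
         (preimage_set_system setT (zeta j) measurable
          `|` preimage_set_system setT (xi j) measurable)) >>.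

Definition full_history (x : nat -> Omega -> 'cV[R]_n)
    (zeta : nat -> Omega -> Z) (xi : nat -> Omega -> Xi) : set (set Omega) :=
  <<s \bigcup_k history x zeta xi k >>.

Definition independent_of (P : probability Omega R) (F : set (set Omega))
    {d} {T : measurableType d} (Y : Omega -> T) : Prop :=
  forall (A : set Omega) (B : set T), F A -> measurable B ->
    P (A `&` Y @^-1` B) = (P A * P (Y @^-1` B))%E.

(* x is a sequence of iterates of the cubic regularized Newton method with
   recursive momentum, driven by the samples zeta and xi of laws PZ and PXi. *)
Record scrn_rm (PZ : probability Z R) (PXi : probability Xi R)
    (P : probability Omega R)
    (G : R -> 'cV[R]_n -> Z -> 'cV[R]_n) (H : 'cV[R]_n -> Xi -> 'M[R]_n)
    (x0 : 'cV[R]_n) (eta delta theta : nat -> R)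
    (zeta : nat -> {RV P >-> Z}) (xi : nat -> {RV P >-> Xi})
    (x : nat -> {RV P >-> 'cV[R]_n}) : Prop := {
  scrn_start : forall w, x 0 w = x0;
  scrn_law_zeta : forall k B, measurable B ->
    distribution P (zeta k) B = PZ B;
  scrn_law_xi : forall k B, measurable B ->
    distribution P (xi k) B = PXi B;
  scrn_fresh : forall k,
    independent_of P (history x zeta xi k) (fun w => (zeta k w, xi k w));
  scrn_step : forall k w (y : 'cV[R]_n),
    let g := G (delta k) (x k w) (zeta k w) in
    let M := momentum_hess H theta x xi k w in
    cubic_model g M (eta k) (x k w) (x k.+1 w)
      <= cubic_model g M (eta k) (x k w) y
}.

Definition uniform_index (P : probability Omega R) (K : nat)
    (iota : Omega -> nat) : Prop :=
  forall k, (1 <= k <= K)%N -> P (iota @^-1` [set k]) = (K%:R^-1)%:E.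

(* (eps_g, eps_H)-stochastic second-order stationary point. *)
Definition stochastic_sosp (P : probability Omega R) (f : 'cV[R]_n -> R)
    (eps_g eps_H : R) (X : Omega -> 'cV[R]_n) : Prop :=
  ('E_P[(fun w => euclid_norm (grad f (X w)) `^ (3 / 2))%R]
     <= (eps_g `^ (3 / 2))%R%:E
   /\ (- eps_H ^+ 3)%R%:E <= 'E_P[(fun w => lambda_min (hess f (X w)) ^+ 3)%R])%E.

End Algorithm.

Definition M_rm {R : realType} (f0 f_low L_F L_H sigma : R) : R :=
  75 * (f0 - f_low + sigma ^+ 3 * (L_F ^+ 3 + L_H ^+ 3) `^ (- (2 / 3))
        + (L_F ^+ 3 + L_H ^+ 3) * sigma ^+ 3 + 1).

(* Main.v *)
(* A step x -> x + s of the cubic model, with r = |s|, e the gradient error and N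
   the Frobenius norm of the Hessian error, decreases f by at least
   r^3 / (11 eta) - O(sqrt eta e^(3/2) + eta^2 N^3), while |grad f|^(3/2) and
   max(0, - lambda_min)^3 at the new point are bounded by combinations of r^3,
   e^(3/2) and N^3.  The momentum error M_k - hess f x_k changes by the factor
   1 - theta plus a noise which is centered conditionally on the past; since
   |a + b|^3 <= |a|^3 + 3 |a| <a, b> + 3 |a| |b|^2 + |b|^3, the cross term
   vanishes in expectation and
     E N_(k+1)^3 <= (1 - theta) E N_k^3
       + (5 / (2 sqrt theta)) (4 theta^3 sigma^3 + 16 (L_F^3 + L_H^3) E r_k^3).
   With the given schedule, theta is a multiple of eta^2 and summing both
   recursions over k < K bounds the sums of E r_k^3 / eta and eta^2 E N_k^3
   independently of K. *)

Require Import Defs.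
From mathcomp Require Import all_boot all_order all_algebra.
From mathcomp Require Import all_classical all_reals all_analysis.
From mathcomp Require Import measurable_realfun ring lra.

Set Implicit Arguments.
Unset Strict Implicit.
Unset Printing Implicit Defensive.

Import Order.TTheory GRing.Theory Num.Theory.
Import numFieldNormedType.Exports.

Local Open Scope classical_set_scope.
Local Open Scope ring_scope.

(** The two recursions are coupled: the Hessian error spoils the descent, and long steps spoil the
    Hessian error. Since [theta = (25 l eta)^2] with [l = (L_F^3 + L_H^3)^(1/3)], going once around
    this loop multiplies by less than 1/8, which is why both sums can be bounded at once. The
    momentum matrix need not be symmetric, and stationarity of the model only sees its symmetric
    part; comparing it with the Hessian therefore requires the symmetry of the Hessian, which is
    derived here from its Lipschitz bound. On the probabilistic side, conditional expectations are
    replaced by freezing the past and integrating out the fresh sample. No moment of the iterates is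
    known to be finite beforehand: all integrands are arranged to be nonnegative, the inequalities
    are proved in the extended reals, and finiteness follows by induction on [k]. *)

Lemma le_of_eq d (T : porderType d) (a b : T) : a = b -> (a <= b)%O.
Proof. by move=> ->. Qed.

(** * Euclidean and Frobenius norms *)

Section L2.
Context {R : realType} {I : finType}.
Implicit Types a b : I -> R.

Definition l2 a : R := Num.sqrt (\sum_i a i ^+ 2).

Lemma l2_ge0 a : 0 <= l2 a. Proof. exact: sqrtr_ge0. Qed.

Lemma sqr_l2 a : l2 a ^+ 2 = \sum_i a i ^+ 2.
Proof. by rewrite sqr_sqrtr// sumr_ge0// => i _; exact: sqr_ge0. Qed.

Lemma l2_eq0 a : l2 a = 0 -> forall i, a i = 0.
Proof.
move=> a0 i; apply/eqP; rewrite -sqrf_eq0; apply/eqP.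
have /psumr_eq0P : \sum_i a i ^+ 2 = 0 by rewrite -sqr_l2 a0 expr0n.
by apply => // j _; exact: sqr_ge0.
Qed.

Lemma cauchy_schwarz a b : \sum_i a i * b i <= l2 a * l2 b.
Proof.
have [b0|b0] := eqVneq (l2 b) 0.
  rewrite b0 mulr0 big1// => i _; by rewrite (l2_eq0 b0) mulr0.
have B0 : 0 < l2 b by rewrite lt_def b0 l2_ge0.
set C := \sum_i _.
suff : C ^+ 2 <= (l2 a * l2 b) ^+ 2.
  have P0 : 0 <= l2 a * l2 b by rewrite mulr_ge0// l2_ge0.
  case: (lerP 0 C) => [C0|/ltW C0 _]; last exact: le_trans P0.
  by rewrite ler_pXn2r.
(* This is the residual of projecting [a] onto [b], multiplied by [l2 b ^+ 2] to avoid a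
   division. *)
have : 0 <= \sum_i (a i * l2 b ^+ 2 - b i * C) ^+ 2.
  by apply: sumr_ge0 => i _; exact: sqr_ge0.
under eq_bigr do rewrite sqrrB !exprMn -[_ *+ 2]mulr_natl.
rewrite !big_split/= -!mulr_suml -!sqr_l2 sumrN.
rewrite [X in _ - X + _](_ : _ = 2 * C ^+ 2 * l2 b ^+ 2); last first.
  rewrite -mulr_sumr.
  rewrite (eq_bigr (fun i => (a i * b i) * (l2 b ^+ 2 * C))); last by move=> i _; ring.
  rewrite -mulr_suml -/C; ring.
rewrite (_ : _ + _ = l2 b ^+ 2 * ((l2 a * l2 b) ^+ 2 - C ^+ 2)); last by ring.
by rewrite pmulr_rge0 ?exprn_gt0// subr_ge0.
Qed.

Lemma sqr_l2D a b :
  l2 (fun i => a i + b i) ^+ 2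
  = l2 a ^+ 2 + 2 * (\sum_i a i * b i) + l2 b ^+ 2.
Proof.
rewrite !sqr_l2 mulr_sumr -!big_split/=.
by apply: eq_bigr => i _; ring.
Qed.

Lemma l2N a : l2 (fun i => - a i) = l2 a.
Proof. by congr Num.sqrt; apply: eq_bigr => i _; rewrite sqrrN. Qed.

Lemma l2D a b : l2 (fun i => a i + b i) <= l2 a + l2 b.
Proof.
rewrite -(@ler_pXn2r _ 2)// ?nnegrE ?addr_ge0 ?l2_ge0// sqr_l2D sqrrD.
by have := cauchy_schwarz a b; rewrite -mulr_natl; lra.
Qed.

Lemma l2Z (c : R) a : l2 (fun i => c * a i) = `|c| * l2 a.
Proof.
apply/eqP; rewrite -(@eqrXn2 _ 2)// ?mulr_ge0 ?l2_ge0//.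
rewrite exprMn !sqr_l2 real_normK ?num_real// mulr_sumr.
by apply/eqP/eq_bigr => i _; rewrite exprMn.
Qed.

(* The cube of the norm has Hessian at most [6 * l2 _]; with
   [N = l2 (a + b)], this is
   [N^3 - l2 a^3 - 3 l2 a <a, b> - (3/2) l2 a (l2 b)^2 =
    (N - l2 a)^2 (N + l2 a / 2)]. *)
Lemma cube_l2D a b :
  l2 (fun i => a i + b i) ^+ 3
  <= l2 a ^+ 3 + 3 * l2 a * (\sum_i a i * b i)
     + 3 * l2 a * l2 b ^+ 2 + l2 b ^+ 3.
Proof.
have := sqr_l2D a b; have := l2D a b.
have : l2 a <= l2 (fun i => a i + b i) + l2 b.
  have -> : l2 a = l2 (fun i => (a i + b i) + - b i).
    by congr l2; apply/funext => i; rewrite addrK.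
  by apply: le_trans (l2D _ _) _; rewrite l2N.
have := l2_ge0 (fun i => a i + b i).
move: (l2_ge0 a) (l2_ge0 b).
move: (l2 (fun i => a i + b i)) (l2 a) (l2 b) (\sum_i _) => N A B c.
move=> A0 B0 N0 h1 h2 h3.
have -> : N ^+ 3 = (3 / 2 * A * N ^+ 2 - A ^+ 3 / 2) + (N - A) ^+ 2 * (N + A / 2).
  by field.
(* Both triangle inequalities enter here. The bound is [B^3 + (3/2) A B^2], and the second term
   doubles the [(3/2) A B^2] already present. *)
have h4 : (N - A) ^+ 2 * (N + A / 2) <= B ^+ 2 * (A + B + A / 2).
  apply: ler_pM => //; [exact: sqr_ge0|lra| |lra].
  by rewrite -subr_ge0 subr_sqr; apply: mulr_ge0; lra.
rewrite h3; apply: le_trans (lerD (lexx _) h4) _.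
apply: le_of_eq; by field.
Qed.

End L2.

Section Dot.
Context {R : realType}.

Definition dot n (u v : 'cV[R]_n) : R := (u^T *m v) 0 0.

Lemma dotE n (u v : 'cV[R]_n) : dot u v = \sum_i u i 0 * v i 0.
Proof. by rewrite /dot mxE; apply: eq_bigr => i _; rewrite mxE. Qed.

Lemma dotC n (u v : 'cV[R]_n) : dot u v = dot v u.
Proof. by rewrite !dotE; apply: eq_bigr => i _; rewrite mulrC. Qed.

Lemma dotDl n (u v w : 'cV[R]_n) : dot (u + v) w = dot u w + dot v w.
Proof. by rewrite /dot linearD/= mulmxDl mxE. Qed.

Lemma dotDr n (u v w : 'cV[R]_n) : dot u (v + w) = dot u v + dot u w.
Proof. by rewrite /dot mulmxDr mxE. Qed.

Lemma dotZl n c (u v : 'cV[R]_n) : dot (c *: u) v = c * dot u v.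
Proof. by rewrite /dot linearZ/= -scalemxAl mxE. Qed.

Lemma dotZr n c (u v : 'cV[R]_n) : dot u (c *: v) = c * dot u v.
Proof. by rewrite /dot -scalemxAr mxE. Qed.

Lemma dotNl n (u v : 'cV[R]_n) : dot (- u) v = - dot u v.
Proof. by rewrite -scaleN1r dotZl mulN1r. Qed.

Lemma dotNr n (u v : 'cV[R]_n) : dot u (- v) = - dot u v.
Proof. by rewrite -scaleN1r dotZr mulN1r. Qed.

Lemma dot0r n (u : 'cV[R]_n) : dot u 0 = 0.
Proof. by rewrite -(scale0r 0) dotZr mul0r. Qed.

Lemma euclid_normE n (u : 'cV[R]_n) : euclid_norm u = l2 (fun i => u i 0).
Proof. by []. Qed.

Lemma frob_normE m n (A : 'M[R]_(m, n)) :
  frob_norm A = l2 (fun p : 'I_m * 'I_n => A p.1 p.2).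
Proof. by rewrite /frob_norm /l2 pair_big. Qed.

Lemma dotvv n (u : 'cV[R]_n) : dot u u = euclid_norm u ^+ 2.
Proof. by rewrite euclid_normE sqr_l2 dotE; apply: eq_bigr. Qed.

Lemma euclid_norm_ge0 n (u : 'cV[R]_n) : 0 <= euclid_norm u.
Proof. exact: l2_ge0. Qed.

Lemma frob_norm_ge0 m n (A : 'M[R]_(m, n)) : 0 <= frob_norm A.
Proof. by rewrite frob_normE l2_ge0. Qed.

Lemma dot_le n (u v : 'cV[R]_n) : dot u v <= euclid_norm u * euclid_norm v.
Proof. rewrite dotE; exact: cauchy_schwarz. Qed.

Lemma euclid_normD n (u v : 'cV[R]_n) :
  euclid_norm (u + v) <= euclid_norm u + euclid_norm v.
Proof.
rewrite !euclid_normE; apply: le_trans (l2D _ _).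
by apply: le_of_eq; congr l2; apply/funext => i; rewrite mxE.
Qed.

Lemma euclid_normZ n c (u : 'cV[R]_n) :
  euclid_norm (c *: u) = `|c| * euclid_norm u.
Proof.
by rewrite !euclid_normE -l2Z; congr l2; apply/funext => i; rewrite mxE.
Qed.

Lemma euclid_normN n (u : 'cV[R]_n) : euclid_norm (- u) = euclid_norm u.
Proof. by rewrite -scaleN1r euclid_normZ normrN1 mul1r. Qed.

Lemma euclid_norm0 n : euclid_norm (0 : 'cV[R]_n) = 0.
Proof. by rewrite -(scale0r 0) euclid_normZ normr0 mul0r. Qed.

Lemma euclid_norm_eq0 n (u : 'cV[R]_n) : euclid_norm u = 0 -> u = 0.
Proof.
rewrite euclid_normE => /l2_eq0 u0; apply/matrixP => i j.
by rewrite (ord1 j) mxE; exact: u0.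
Qed.

Lemma frob_normD m n (A B : 'M[R]_(m, n)) :
  frob_norm (A + B) <= frob_norm A + frob_norm B.
Proof.
rewrite !frob_normE; apply: le_trans (l2D _ _).
by apply: le_of_eq; congr l2; apply/funext => i; rewrite mxE.
Qed.

Lemma frob_normZ m n c (A : 'M[R]_(m, n)) :
  frob_norm (c *: A) = `|c| * frob_norm A.
Proof.
by rewrite !frob_normE -l2Z; congr l2; apply/funext => i; rewrite mxE.
Qed.

Lemma frob_normN m n (A : 'M[R]_(m, n)) : frob_norm (- A) = frob_norm A.
Proof. by rewrite -scaleN1r frob_normZ normrN1 mul1r. Qed.

Lemma frob_norm_mulmx m n (A : 'M[R]_(m, n)) (v : 'cV[R]_n) :
  euclid_norm (A *m v) <= frob_norm A * euclid_norm v.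
Proof.
rewrite -(@ler_pXn2r _ 2)// ?nnegrE ?mulr_ge0 ?frob_norm_ge0 ?euclid_norm_ge0//.
rewrite exprMn {1}euclid_normE sqr_l2 frob_normE sqr_l2.
rewrite -(pair_big xpredT xpredT (fun i j => A i j ^+ 2))/= mulr_suml.
apply: ler_sum => i _; rewrite mxE.
rewrite -(sqr_l2 (fun j => A i j)) euclid_normE -exprMn.
set S := \sum_j _.
rewrite -(@real_normK _ S) ?num_real// ler_pXn2r ?nnegrE ?mulr_ge0 ?l2_ge0//.
rewrite ler_norml; apply/andP; split; last exact: cauchy_schwarz.
rewrite lerNl -(l2N (fun j => A i j)) -sumrN.
apply: le_trans (cauchy_schwarz _ _).
by apply: ler_sum => j _; rewrite mulNr.
Qed.

Lemma spectral_norm_mulmx m n (A : 'M[R]_(m, n)) (v : 'cV[R]_n) :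
  euclid_norm (A *m v) <= spectral_norm A * euclid_norm v.
Proof.
have [v0|v0] := eqVneq (euclid_norm v) 0.
  by rewrite (euclid_norm_eq0 v0) mulmx0 !euclid_norm0 mulr0.
have vp : 0 < euclid_norm v by rewrite lt_def v0 euclid_norm_ge0.
rewrite -ler_pdivrMr// mulrC.
have -> : (euclid_norm v)^-1 * euclid_norm (A *m v)
        = euclid_norm (A *m ((euclid_norm v)^-1 *: v)).
  by rewrite -scalemxAr euclid_normZ ger0_norm// invr_ge0 ltW.
(* The Frobenius norm bounds the set, so that [sup] is a true supremum and not a default value. *)
apply: ub_le_sup.
  exists (frob_norm A) => _ [w /= w1 <-].
  apply: le_trans (frob_norm_mulmx _ _) _.
  by rewrite -{2}[frob_norm A]mulr1 ler_wpM2l ?frob_norm_ge0.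
exists ((euclid_norm v)^-1 *: v) => //=.
by rewrite euclid_normZ ger0_norm ?invr_ge0 ?euclid_norm_ge0// mulVf.
Qed.

Lemma mulmx_dot_le m n (A : 'M[R]_(m, n)) (u : 'cV[R]_m) (v : 'cV[R]_n) :
  dot u (A *m v) <= frob_norm A * (euclid_norm u * euclid_norm v).
Proof.
apply: le_trans (dot_le _ _) _; rewrite mulrCA ler_wpM2l ?euclid_norm_ge0//.
exact: frob_norm_mulmx.
Qed.

Lemma spectral_dot_le m n (A : 'M[R]_(m, n)) (u : 'cV[R]_m) (v : 'cV[R]_n) :
  dot u (A *m v) <= spectral_norm A * (euclid_norm u * euclid_norm v).
Proof.
apply: le_trans (dot_le _ _) _; rewrite mulrCA ler_wpM2l ?euclid_norm_ge0//.
exact: spectral_norm_mulmx.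
Qed.

End Dot.

Definition dotE_lin := (@dotDl, @dotDr, @dotZl, @dotZr, @dotNl, @dotNr).

(** * Global minimizers of the cubic model *)

Section CubicModel.
Context {R : realType}.

Lemma linear_part_eq0 (a C : R) :
  (forall t, `|t| <= 1 -> 0 <= t * a + t ^+ 2 * C) -> a = 0.
Proof.
move=> h; apply/eqP/negPn/negP => a0.
have ap : 0 < `|a| by rewrite normr_gt0.
(* [D] stays abstract, known only through [DE]. At [t = - a / (2 D)] the linear term beats the
   quadratic one. *)
have [D DE] : exists D, D = `|a| + `|C| by eexists.
have D0 : 0 < D by rewrite DE ltr_wpDr.
have t1 : `|- a / (2 * D)| <= 1.
  rewrite normrM normrN normfV (gtr0_norm (_ : 0 < 2 * D)) ?mulr_gt0//.
  by rewrite ler_pdivrMr ?mulr_gt0// mul1r DE; have := normr_ge0 C; lra.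
have := h _ t1; apply/negP; rewrite -ltNge.
have -> : - a / (2 * D) * a + (- a / (2 * D)) ^+ 2 * C
   = (a / (2 * D)) ^+ 2 * (C - 2 * D) by field; lra.
rewrite pmulr_rlt0; last first.
  by rewrite exprn_even_gt0//= mulf_neq0// invr_eq0 gt_eqF// mulr_gt0.
by have := ler_norm C; lra.
Qed.

(** This is the limit [t -> 0+], made explicit: if [q < 0], then at [t = - q / (2 D)] the remainder
    is at most [- q / 2]. *)
Lemma constant_part_ge0 (q B C : R) :
  (forall t, 0 < t <= 1 -> 0 <= q + t * B + t ^+ 2 * C) -> 0 <= q.
Proof.
move=> h; rewrite leNgt; apply/negP => q0.
have [D DE] : exists D, D = `|B| + `|C| - q by eexists.
have qD : - q <= D by rewrite DE; have := normr_ge0 B; have := normr_ge0 C; lra.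
have D0 : 0 < D by lra.
pose t := - q / (2 * D).
have t0 : 0 < t by rewrite divr_gt0//; lra.
have t1 : t <= 1 by rewrite ler_pdivrMr; lra.
have : q + t * B + t ^+ 2 * C < 0; last first.
  by apply/negP; rewrite -leNgt; apply: h; rewrite t0.
have tD : t * D = - q / 2 by rewrite /t; field; rewrite gt_eqF.
have : t * B <= t * `|B| by rewrite ler_wpM2l ?ler_norm// ltW.
have : t ^+ 2 * C <= t * `|C|.
  apply: le_trans (_ : t ^+ 2 * `|C| <= _).
    by rewrite ler_wpM2l ?sqr_ge0 ?ler_norm.
  by rewrite ler_wpM2r// expr2 -{3}[t]mulr1 ler_wpM2l// ltW.
have : t * D = t * `|B| + t * `|C| - t * q by rewrite DE; ring.
have : 0 <= - (t * q) by rewrite -mulrN mulr_ge0//; lra.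
lra.
Qed.

Context {n : nat}.
Implicit Types (g s d x y : 'cV[R]_n) (M : 'M[R]_n).

Lemma cubic_model_dot g M eta x s :
  cubic_model g M eta x (x + s)
  = dot g s + 2^-1 * dot s (M *m s) + (6 * eta)^-1 * euclid_norm s ^+ 3.
Proof.
by rewrite /cubic_model (_ : x + s - x = s) ?(addrC x) ?addrK// /dot mulmxA.
Qed.

Lemma sqr_euclid_normD (u v : 'cV[R]_n) :
  euclid_norm (u + v) ^+ 2 = euclid_norm u ^+ 2 + 2 * dot u v + euclid_norm v ^+ 2.
Proof. by rewrite -!dotvv !dotE_lin (dotC v u); ring. Qed.

Variables (g : 'cV[R]_n) (M : 'M[R]_n) (eta : R) (x s : 'cV[R]_n).
Hypothesis eta0 : 0 < eta.
Hypothesis smin : forall y,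
  cubic_model g M eta x (x + s) <= cubic_model g M eta x y.
Let r := euclid_norm s.

(** [M] may be non-symmetric, hence the two separate cross terms. *)
Lemma cubic_increment_ge0 t d :
  0 <= t * (dot g d + 2^-1 * (dot d (M *m s) + dot s (M *m d)))
       + t ^+ 2 * (2^-1 * dot d (M *m d))
       + (6 * eta)^-1 * (euclid_norm (s + t *: d) ^+ 3 - r ^+ 3).
Proof.
have := smin (x + (s + t *: d)); rewrite !cubic_model_dot -subr_ge0 -/r.
rewrite mulmxDr -scalemxAr !dotE_lin.
set u := dot d (M *m s); set v := dot s (M *m d); set w := dot d (M *m d).
by set N := euclid_norm _ => h; apply: le_trans h _; apply: le_of_eq; ring.
Qed.

(** Stationarity of the model along [d]. The cube of the norm is expanded by hand up to a quadratic
    error in [t], uniformly in [s]; the case [s = 0], where the norm is not differentiable, is thus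
    included. *)
Lemma cubic_first_order d :
  dot g d + 2^-1 * (dot d (M *m s) + dot s (M *m d)) + r / (2 * eta) * dot s d = 0.
Proof.
set D := euclid_norm d.
have r0 : 0 <= r by exact: euclid_norm_ge0.
have D0 : 0 <= D by exact: euclid_norm_ge0.
apply: (@linear_part_eq0 _ (2^-1 * dot d (M *m d)
   + (6 * eta)^-1 * (3 / 2 * r * D ^+ 2 + 2^-1 * D ^+ 2 * (2 * (r + D) + r)))).
move=> t t1; have := cubic_increment_ge0 t d.
set N := euclid_norm _.
have N0 : 0 <= N by exact: euclid_norm_ge0.
have tD0 : euclid_norm (t *: d) = `|t| * D by rewrite euclid_normZ.
have tD1 : `|t| * D <= D by rewrite -{2}[D]mul1r ler_wpM2r.
have N1 : N <= r + `|t| * D by rewrite -tD0; exact: euclid_normD.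
have N2 : r <= N + `|t| * D.
  rewrite -tD0 -[euclid_norm (t *: d)]euclid_normN.
  by apply: le_trans (euclid_normD _ _); rewrite addrK.
have NE : N ^+ 2 = r ^+ 2 + 2 * (t * dot s d) + t ^+ 2 * D ^+ 2.
  by rewrite sqr_euclid_normD dotZr tD0 exprMn real_normK ?num_real.
have h1 : (N - r) ^+ 2 <= t ^+ 2 * D ^+ 2.
  rewrite -(real_normK (num_real t)) -exprMn -subr_ge0 subr_sqr.
  by apply: mulr_ge0; lra.
have h2 : (N - r) ^+ 2 * (2 * N + r) <= (t ^+ 2 * D ^+ 2) * (2 * (r + D) + r).
  by apply: ler_pM; [exact: sqr_ge0 | lra | done | lra].
have h3 : N ^+ 3 - r ^+ 3 <= 3 * r * (t * dot s d)
   + t ^+ 2 * (3 / 2 * r * D ^+ 2 + 2^-1 * D ^+ 2 * (2 * (r + D) + r)).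
  (* [N^2 - r^2] is an exact quadratic in [t], so only the part with [(N - r)^2] needs an
     estimate. *)
  have -> : N ^+ 3 - r ^+ 3 = 3 / 2 * r * (N ^+ 2 - r ^+ 2)
     + 2^-1 * ((N - r) ^+ 2 * (2 * N + r)) by field.
  by rewrite NE; lra.
have e6 : 0 < (6 * eta)^-1 by rewrite invr_gt0 mulr_gt0.
move: h3; rewrite -(ler_pM2l e6) => h3.
set A := dot g d + _; set w := dot d _ in h3 *.
move=> h4; apply: le_trans h4 (le_trans (lerD (lexx _) h3) _).
apply: le_of_eq; field; exact: lt0r_neq0.
Qed.

Let Q d := dot d (M *m d) + r / (2 * eta) * dot d d.

(** The hypothesis puts [s + t d] on the sphere of radius [r], where the cubic terms cancel.
    Eliminating [g] by the first-order condition leaves exactly [t^2 Q d / 2]. *)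
Lemma cubic_second_order_sphere t d : t != 0 ->
  2 * (t * dot s d) + t ^+ 2 * dot d d = 0 -> 0 <= Q d.
Proof.
move=> t0 h.
have N : euclid_norm (s + t *: d) = r.
  apply/eqP; rewrite -(@eqrXn2 _ 2)// ?euclid_norm_ge0// -!dotvv !dotE_lin (dotC d s).
  by apply/eqP; move: h; rewrite expr2; lra.
have := cubic_increment_ge0 t d; rewrite N subrr mulr0 addr0.
have := cubic_first_order d.
set A := dot g d + _ => /eqP; rewrite addr_eq0 => /eqP ->.
have t2 : 0 < t ^+ 2 by rewrite exprn_even_gt0.
rewrite -(pmulr_rge0 (Q d) t2).
have -> : t * - (r / (2 * eta) * dot s d) = r / (4 * eta) * (t ^+ 2 * dot d d).
  have -> : t ^+ 2 * dot d d = - (2 * (t * dot s d)) by lra.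
  field; exact: lt0r_neq0.
have -> : t ^+ 2 * Q d = 2 * (r / (4 * eta) * (t ^+ 2 * dot d d)
    + t ^+ 2 * (2^-1 * dot d (M *m d))) by rewrite /Q; field; exact: lt0r_neq0.
by move=> ?; rewrite mulr_ge0.
Qed.

(* Global minimality gives [M + r / (2 eta) I >= 0], stronger than the local
   second-order condition: compare with the points of the sphere through [s]. *)
Lemma cubic_second_order d : 0 <= Q d.
Proof.
have nz e : dot s e != 0 -> 0 <= Q e.
  move=> se.
  have e0 : dot e e != 0.
    apply: contraNN se => /eqP; rewrite dotvv => /eqP.
    by rewrite sqrf_eq0 => /eqP/euclid_norm_eq0 ->; rewrite dot0r.
  (* The second intersection of the line through [s] directed by [e] with the sphere. *)
  apply: (@cubic_second_order_sphere (- (2 * dot s e) / dot e e)).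
    by rewrite mulf_neq0 ?invr_eq0// oppr_eq0 mulf_neq0// pnatr_eq0.
  by field.
(* What remains is a line tangent to the sphere, or a sphere reduced to a point. *)
have [sd|/nz//] := eqVneq (dot s d) 0.
have [r0|r0] := eqVneq r 0.
  have s0 : s = 0 by exact: euclid_norm_eq0.
  have := cubic_first_order d; set A := dot g d + _.
  rewrite s0 dotC dot0r mulr0 addr0 => A0.
  rewrite /Q r0 !mul0r addr0.
  (* The linear part vanishes by stationarity and the regularizer is of order [t^3]: divide by
     [t^2 / 2] and let [t] tend to 0. *)
  apply: (@constant_part_ge0 _ ((3 * eta)^-1 * euclid_norm d ^+ 3) 0) => t /andP[t0 t1].
  have := cubic_increment_ge0 t d; rewrite -/A A0 mulr0 add0r r0 s0 add0r.
  rewrite euclid_normZ gtr0_norm// expr0n subr0 => h.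
  rewrite mulr0 addr0 -(@pmulr_rge0 _ (t ^+ 2 / 2)); last by rewrite divr_gt0 ?exprn_gt0.
  set u := dot d (M *m d) in h *; set D := euclid_norm d in h *.
  apply: le_trans h _; apply: le_of_eq; field; exact: lt0r_neq0.
(* Tilting [d] towards [s] makes the line cross the sphere a second time; then the tilt tends to
   0. *)
apply: (@constant_part_ge0 _ (dot s (M *m d) + dot d (M *m s)) (Q s)) => t /andP[t0 t1].
have : 0 <= Q (d + t *: s).
  apply: nz; rewrite dotDr sd dotZr add0r dotvv mulf_neq0 ?sqrf_eq0//; lra.
rewrite /Q mulmxDr -scalemxAr !dotE_lin (dotC d s) sd.
by move=> h; apply: le_trans h _; apply: le_of_eq; ring.
Qed.

(** The first-order condition at [d = s] eliminates [dot g s], the second-order one bounds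
    [- dot s (M *m s) / 2] by [r^3 / (4 eta)], and [1/4 + 1/6 - 1/2 = - 1/12]. *)
Lemma cubic_model_decrease :
  cubic_model g M eta x (x + s) <= - (r ^+ 3 / (12 * eta)).
Proof.
rewrite cubic_model_dot -/r.
have := cubic_first_order s; have := cubic_second_order s.
rewrite /Q dotvv -/r; set u := dot s _.
have -> : (6 * eta)^-1 * r ^+ 3 = 2 * (r ^+ 3 / (12 * eta)) by field; exact: lt0r_neq0.
have -> : r / (2 * eta) * r ^+ 2 = 6 * (r ^+ 3 / (12 * eta)) by field; exact: lt0r_neq0.
by lra.
Qed.

End CubicModel.

(** * Taylor expansions for a Lipschitz Hessian *)

Section Taylor.
Context {R : realType}.

(** This takes the place of integration: each Taylor bound below follows from the bound of the next
    order by comparing derivatives along a segment. *)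
Lemma is_derive_le (phi psi dphi dpsi : R -> R) (t : R) :
  (forall u : R, is_derive u 1 phi (dphi u)) ->
  (forall u : R, is_derive u 1 psi (dpsi u)) ->
  (forall u, 0 <= u <= 1 -> dphi u <= dpsi u) -> 0 <= t <= 1 ->
  phi t - phi 0 <= psi t - psi 0.
Proof.
move=> hphi hpsi hle t01.
have hd (u : R) : is_derive u 1 (phi - psi) (dphi u - dpsi u).
  by apply: is_deriveB.
suff : (phi - psi) t <= (phi - psi) 0 by rewrite /= !fctE; lra.
apply: (@ler0_derive1_le _ _ 0 1 _ _ true false); rewrite ?in_itv/= ?lexx ?ler01//.
- move=> u; rewrite in_itv/= => /andP[u0 u1].
  by rewrite derive1E derive_val subr_le0 hle// !ltW.
- apply: derivable_within_continuous => u _; exact: ex_derive.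
- by case/andP: t01.
Qed.

Context {n : nat}.
Implicit Types (f : 'cV[R]_n -> R) (x s u v : 'cV[R]_n).

Lemma is_derive_line (g : 'cV[R]_n -> R) x s (t : R) :
  derivable g (x + t *: s) s ->
  is_derive t 1 (fun t => g (x + t *: s)) ('D_s g (x + t *: s)).
Proof.
have E : (fun h : R => h^-1 *: (((fun t => g (x + t *: s)) \o shift t) (h *: 1)
             - g (x + t *: s)))
  = (fun h : R => h^-1 *: ((g \o shift (x + t *: s)) (h *: s) - g (x + t *: s))).
  apply/funext => h /=; congr (_ *: (g _ - _)).
  by rewrite [h *: 1]mulr1 scalerDl addrCA.
by move=> dg; split; rewrite /derivable /derive E.
Qed.

Lemma derive_partial (g : 'cV[R]_n -> R) x s : differentiable g x ->
  'D_s g x = \sum_i s i 0 * 'D_(delta_mx i 0) g x.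
Proof.
move=> dg; rewrite deriveE//.
have {1}-> : s = \sum_i s i 0 *: delta_mx i 0.
  rewrite {1}(matrix_sum_delta s); apply: eq_bigr => i _.
  by rewrite big_ord_recl big_ord0 addr0.
rewrite linear_sum; apply: eq_bigr => i _.
by rewrite linearZ/= deriveE.
Qed.

Variables (f : 'cV[R]_n -> R) (L : R).
Hypothesis L0 : 0 < L.
Hypothesis f_C2 : twice_cont_diff f.
Hypothesis hess_lip : forall x y,
  spectral_norm (hess f y - hess f x) <= L * euclid_norm (y - x).

Lemma is_derive_fun_line x s (t : R) :
  is_derive t 1 (fun t => f (x + t *: s)) (dot s (grad f (x + t *: s))).
Proof.
have [df _ _] := f_C2.
have -> : dot s (grad f (x + t *: s)) = 'D_s f (x + t *: s).
  by rewrite derive_partial// dotE; apply: eq_bigr => i _; rewrite mxE.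
exact/is_derive_line/diff_derivable.
Qed.

Lemma differentiable_grad_coord x i : differentiable (fun y => grad f y i 0) x.
Proof.
have [_ dg _] := f_C2.
apply: (@differentiable_comp _ _ _ _ (grad f) (fun N : 'cV[R]_n => N i 0)) => //.
exact: differentiable_coord.
Qed.

Lemma is_derive_grad_line u x s (t : R) :
  is_derive t 1 (fun t => dot u (grad f (x + t *: s)))
    (dot u (hess f (x + t *: s) *m s)).
Proof.
have -> : (fun t => dot u (grad f (x + t *: s)))
   = \sum_i (u i 0 *: (fun t => grad f (x + t *: s) i 0)).
  by apply/funext => w; rewrite dotE fct_sumE; apply: eq_bigr.
have -> : dot u (hess f (x + t *: s) *m s)
   = \sum_i (u i 0 *: 'D_s (fun y => grad f y i 0) (x + t *: s)).
  rewrite dotE; apply: eq_bigr => i _; congr (_ * _).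
  rewrite derive_partial; last exact: differentiable_grad_coord.
  by rewrite mxE; apply: eq_bigr => j _; rewrite mxE mulrC.
apply: is_derive_sum => i; apply: is_deriveZ.
apply: (@is_derive_line (fun y => grad f y i 0)).
exact/diff_derivable/differentiable_grad_coord.
Qed.

Lemma hess_dot_le u v x y :
  dot u (hess f y *m v) <=
  dot u (hess f x *m v) + L * euclid_norm (y - x) * (euclid_norm u * euclid_norm v).
Proof.
have -> : hess f y = hess f x + (hess f y - hess f x) by rewrite addrC subrK.
rewrite mulmxDl dotDr lerD2l; apply: le_trans (spectral_dot_le _ _ _) _.
by rewrite ler_wpM2r// mulr_ge0// euclid_norm_ge0.
Qed.

(** The test vector [u] makes the statement scalar, so that [is_derive_le] applies. *)
Lemma grad_taylor_le u x s :
  dot u (grad f (x + s)) <= dot u (grad f x) + dot u (hess f x *m s)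
    + L / 2 * (euclid_norm u * euclid_norm s ^+ 2).
Proof.
set c := dot u (hess f x *m s).
set C := L * (euclid_norm u * euclid_norm s ^+ 2).
have := @is_derive_le (fun t => dot u (grad f (x + t *: s)))
  (fun t => c * t + C / 2 * t ^+ 2) _ (fun t => c + C * t) 1
  (is_derive_grad_line u x s).
rewrite scale1r scale0r addr0 expr1n expr0n/= !mulr0 !mulr1 addr0 subr0.
move=> H; have : dot u (grad f (x + s)) - dot u (grad f x) <= c + C / 2.
  apply: H; rewrite ?lexx ?ler01//.
    move=> t.
    apply: is_derive_eq.
    have scE (a b : R^o) : a *: b = a * b by [].
    by rewrite !scE; field.
  move=> t /andP[t0 t1]; apply: le_trans (hess_dot_le _ _ x _) _.
  rewrite lerD2l addrAC subrr add0r euclid_normZ ger0_norm// /C.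
  by apply: le_of_eq; ring.
by rewrite /C; lra.
Qed.


Lemma taylor_le x s :
  f (x + s) - f x <= dot s (grad f x) + 2^-1 * dot s (hess f x *m s)
    + L / 6 * euclid_norm s ^+ 3.
Proof.
set a := dot s (grad f x); set c := dot s (hess f x *m s).
set C := L * euclid_norm s ^+ 3.
have := @is_derive_le (fun t => f (x + t *: s))
  (fun t => a * t + c / 2 * t ^+ 2 + C / 6 * t ^+ 3)
  _ (fun t => a + c * t + C / 2 * t ^+ 2) 1 (is_derive_fun_line x s).
rewrite scale1r scale0r addr0 !expr1n !expr0n/= !mulr0 !mulr1 !addr0 subr0.
move=> H; have : f (x + s) - f x <= a + c / 2 + C / 6.
  apply: H; rewrite ?lexx ?ler01//.
    move=> t; apply: is_derive_eq.
    have scE (p q : R^o) : p *: q = p * q by [].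
    by rewrite !scE; field.
  move=> t /andP[t0 t1]; apply: le_trans (grad_taylor_le _ _ _) _.
  rewrite euclid_normZ ger0_norm// -scalemxAr dotZr -/a -/c /C.
  by apply: le_of_eq; ring.
by rewrite /C; lra.
Qed.

Lemma taylor_ge x s :
  dot s (grad f x) + 2^-1 * dot s (hess f x *m s)
    - L / 6 * euclid_norm s ^+ 3 <= f (x + s) - f x.
Proof.
set a := dot s (grad f x); set c := dot s (hess f x *m s).
set C := L * euclid_norm s ^+ 3.
have := @is_derive_le 
  (fun t => a * t + c / 2 * t ^+ 2 - C / 6 * t ^+ 3) (fun t => f (x + t *: s))
  (fun t => a + c * t - C / 2 * t ^+ 2) _ 1 _ (is_derive_fun_line x s).
rewrite scale1r scale0r addr0 !expr1n !expr0n/= !mulr0 !mulr1 !addr0 !subr0.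
move=> H; have : a + c / 2 - C / 6 <= f (x + s) - f x.
  apply: H; rewrite ?lexx ?ler01//.
    move=> t; apply: is_derive_eq.
    have scE (p q : R^o) : p *: q = p * q by [].
    by rewrite !scE; field.
  (* With [- s] as test vector, the upper bound on the gradient becomes the lower bound needed
     here. *)
  move=> t /andP[t0 t1]; have := grad_taylor_le (- s) x (t *: s).
  rewrite euclid_normN euclid_normZ ger0_norm// -scalemxAr !dotNl dotZr -/a -/c.
  have -> : L / 2 * (euclid_norm s * (t * euclid_norm s) ^+ 2) = C / 2 * t ^+ 2.
    by rewrite /C; ring.
  by lra.
by rewrite /C; lra.
Qed.

(** The remainder is tested against itself, and one factor of its norm cancels. *)
Lemma grad_taylor_norm x s :
  euclid_norm (grad f (x + s) - grad f x - hess f x *m s)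
  <= L / 2 * euclid_norm s ^+ 2.
Proof.
set w := _ - _ - _.
have [w0|w0] := eqVneq (euclid_norm w) 0.
  by rewrite w0 mulr_ge0 ?sqr_ge0// divr_ge0// ltW.
have wp : 0 < euclid_norm w by rewrite lt_def w0 euclid_norm_ge0.
rewrite -(ler_pM2l wp) -expr2 -(dotvv w).
have -> : dot w w = dot w (grad f (x + s)) - dot w (grad f x) - dot w (hess f x *m s).
  by rewrite -!dotNr -!dotDr.
by have := grad_taylor_le w x s; lra.
Qed.

(* Two second-order expansions of [f (x + t u + t v)], from [x] directly and
   through [x + t u], differ by [t^2 (v . H u - u . H v) / 2 + O(t^3)]. *)
Lemma second_difference (t gu gv uu uv vu vv gv' vv' nuv nu nv f0 fu fuv : R) :
  0 < t ->
  t * (gu + gv) + 2^-1 * (t * (t * (uu + uv + (vu + vv))))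
    - L / 6 * (t * nuv) ^+ 3 <= fuv - f0 ->
  fu - f0 <= t * gu + 2^-1 * (t * (t * uu)) + L / 6 * (t * nu) ^+ 3 ->
  fuv - fu <= t * gv' + 2^-1 * (t * (t * vv')) + L / 6 * (t * nv) ^+ 3 ->
  gv' <= gv + t * vu + L / 2 * (nv * (t * nu) ^+ 2) ->
  vv' <= vv + L * (t * nu) * (nv * nv) ->
  0 <= vu - uv + t * (L * (3^-1 * nuv ^+ 3 + 3^-1 * nu ^+ 3 + 3^-1 * nv ^+ 3
                           + nu ^+ 2 * nv + nu * nv ^+ 2)).
Proof.
move=> t0; rewrite -subr_ge0 => h1; rewrite -subr_ge0 => h2.
rewrite -subr_ge0 => h3; rewrite -subr_ge0 => h4; rewrite -subr_ge0 => h5.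
rewrite -(@pmulr_rge0 _ (t ^+ 2)) ?exprn_gt0//.
(* With the weights 2, 2, 2, [2 t] and [t^2], all values of [f] and the quantities [gv'] and [vv']
   cancel. *)
have := addr_ge0 (mulr_ge0 (ler0n R 2) (addr_ge0 (addr_ge0 h1 h2) h3))
  (addr_ge0 (mulr_ge0 (ler0n R 2) (mulr_ge0 (ltW t0) h4))
            (mulr_ge0 (ltW (exprn_gt0 2 t0)) h5)).
move=> h; apply: le_trans h _.
by apply: le_of_eq; field.
Qed.

(** Expanding [f] at [x + t u + t v] along the two paths leaves the antisymmetric part of the
    Hessian up to an error [C t], and [t] tends to 0. It lets [grad_next_norm] compare both cross
    terms of the model with the same Hessian term. *)
Lemma hess_dotC u v x : dot v (hess f x *m u) = dot u (hess f x *m v).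
Proof.
wlog suff h : u v / dot u (hess f x *m v) <= dot v (hess f x *m u).
  by apply/eqP; rewrite eq_le !h.
rewrite -subr_ge0.
pose C := L * (3^-1 * euclid_norm (u + v) ^+ 3 + 3^-1 * euclid_norm u ^+ 3
  + 3^-1 * euclid_norm v ^+ 3
  + euclid_norm u ^+ 2 * euclid_norm v + euclid_norm u * euclid_norm v ^+ 2).
apply: (@constant_part_ge0 _ _ C 0) => t /andP[t0 t1]; rewrite mulr0 addr0.
have MZ (y a b : 'cV[R]_n) : dot a (hess f y *m (t *: b)) = t * dot a (hess f y *m b).
  by rewrite -scalemxAr dotZr.
have NZ (a : 'cV[R]_n) : euclid_norm (t *: a) = t * euclid_norm a.
  by rewrite euclid_normZ gtr0_norm.
have h1 : t * (dot u (grad f x) + dot v (grad f x))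
    + 2^-1 * (t * (t * (dot u (hess f x *m u) + dot u (hess f x *m v)
        + (dot v (hess f x *m u) + dot v (hess f x *m v)))))
    - L / 6 * (t * euclid_norm (u + v)) ^+ 3 <= f (x + t *: u + t *: v) - f x.
  have := taylor_ge x (t *: (u + v)).
  rewrite MZ NZ mulmxDr !dotZl !dotDl !dotDr scalerDr.
  by rewrite (addrA x (t *: u) (t *: v)) (addrA (_ + _) (dot v _)).
have h2 := taylor_le x (t *: u); rewrite MZ NZ !dotZl in h2.
have h3 := taylor_le (x + t *: u) (t *: v); rewrite MZ NZ !dotZl in h3.
have h4 := grad_taylor_le v x (t *: u); rewrite MZ NZ in h4.
have h5 := hess_dot_le v v x (x + t *: u).
rewrite (_ : x + t *: u - x = t *: u) ?NZ in h5; last by rewrite addrC addKr.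
exact: (second_difference t0 h1 h2 h3 h4 h5).
Qed.

End Taylor.

(** * One step of the cubic Newton method *)

Section Young.
Context {R : realType}.
Implicit Types a b c r : R.

(** The only form of Young's inequality in use; rescaling one argument gives every other weight. *)
Lemma young_sqrl a b : 0 <= a -> 0 <= b -> 3 * (a ^+ 2 * b) <= 2 * a ^+ 3 + b ^+ 3.
Proof.
move=> a0 b0; rewrite -subr_ge0.
have -> : 2 * a ^+ 3 + b ^+ 3 - 3 * (a ^+ 2 * b) = (b - a) ^+ 2 * (b + 2 * a) by ring.
by apply: mulr_ge0; [exact: sqr_ge0|lra].
Qed.

Lemma cubeD_le a b : 0 <= a -> 0 <= b -> (a + b) ^+ 3 <= 4 * (a ^+ 3 + b ^+ 3).
Proof.
move=> a0 b0; rewrite -subr_ge0.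
have -> : 4 * (a ^+ 3 + b ^+ 3) - (a + b) ^+ 3 = 3 * ((a - b) ^+ 2 * (a + b)) by ring.
by rewrite pmulr_rge0// mulr_ge0 ?sqr_ge0 ?addr_ge0.
Qed.

(* With total weight 11/4 <= (5/3)^2, this is
   [y^3 <= sqrt W * (sum of w_i t_i^3)] whenever [y^2 <= sum of w_i t_i^2]. *)
Lemma weighted_cube_le y a b c : 0 <= y -> 0 <= a -> 0 <= b -> 0 <= c ->
  y ^+ 2 <= 5 / 4 * a ^+ 2 + b ^+ 2 + 2^-1 * c ^+ 2 ->
  y ^+ 3 <= 25 / 12 * a ^+ 3 + 5 / 3 * b ^+ 3 + 5 / 6 * c ^+ 3.
Proof.
move=> y0 a0 b0 c0 h.
(* Summing with total weight 11/4 puts [33/100 y^3] on the right, and [(10/9) / (67/100) < 5/3]. *)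
have k t : 0 <= t -> y * t ^+ 2 <= 10 / 9 * t ^+ 3 + 3 / 25 * y ^+ 3.
  move=> t0; have := young_sqrl (mulr_ge0 (_ : 0 <= 5 / 3) t0) y0.
  by rewrite !exprMn => H; have := H ltac:(lra); lra.
have := ler_wpM2l y0 h; rewrite -exprS.
have := k a a0; have := k b b0; have := k c c0.
rewrite !mulrDr (mulrCA y _ (a ^+ 2)) (mulrCA y _ (c ^+ 2)).
have := exprn_ge0 3 y0.
set A := y * a ^+ 2; set B := y * b ^+ 2; set C := y * c ^+ 2.
by lra.
Qed.

End Young.

Section NewtonStep.
Context {R : realType} {n : nat}.
Variables (f : 'cV[R]_n -> R) (L : R).
Hypothesis L0 : 0 < L.
Hypothesis f_C2 : twice_cont_diff f.
Hypothesis hess_lip : forall x y,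
  spectral_norm (hess f y - hess f x) <= L * euclid_norm (y - x).
Variables (g : 'cV[R]_n) (M : 'M[R]_n) (eta : R) (x s : 'cV[R]_n).
Hypothesis eta0 : 0 < eta.
Hypothesis L_eta : 2 * L * eta <= 1.
Hypothesis smin : forall y,
  cubic_model g M eta x (x + s) <= cubic_model g M eta x y.
Let r := euclid_norm s.
Let e := euclid_norm (g - grad f x).
Let N := frob_norm (M - hess f x).

Let r0 : 0 <= r. Proof. exact: euclid_norm_ge0. Qed.
Let e0 : 0 <= e. Proof. exact: euclid_norm_ge0. Qed.
Let N0 : 0 <= N. Proof. exact: frob_norm_ge0. Qed.

Lemma L_le_eta : L <= 2^-1 / eta.
Proof. by rewrite ler_pdivlMr//; move: L_eta; lra. Qed.

(** The regularizer [r^3 / (6 eta)] exceeds the Taylor remainder [L r^3 / 6 <= r^3 / (12 eta)] by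
    [r^3 / (12 eta)], and the decrease of the model contributes the same amount again. *)
Lemma newton_descent :
  f (x + s) <= f x - r ^+ 3 / (6 * eta) + e * r + 2^-1 * (N * r ^+ 2).
Proof.
have h1 := taylor_le f_C2 hess_lip x s.
have h2 := cubic_model_decrease eta0 smin.
rewrite cubic_model_dot -/r in h2; rewrite -/r in h1.
have h3 : dot s (grad f x) <= dot g s + e * r.
  rewrite (dotC s) -lerBlDl -dotNl -dotDl.
  by apply: le_trans (dot_le _ _) _; rewrite -(opprB g) euclid_normN.
have h4 : dot s (hess f x *m s) <= dot s (M *m s) + N * r ^+ 2.
  rewrite -lerBlDl -dotNr -dotDr -mulNmx -mulmxDl.
  apply: le_trans (mulmx_dot_le _ _ _) _.
  by rewrite -(opprB M) frob_normN -expr2.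
have h5 : L * r ^+ 3 <= 2^-1 / eta * r ^+ 3 by rewrite ler_wpM2r ?exprn_ge0// L_le_eta.
have E1 : (6 * eta)^-1 * r ^+ 3 = 6^-1 * (r ^+ 3 / eta) by field; exact: lt0r_neq0.
have E2 : r ^+ 3 / (12 * eta) = 12^-1 * (r ^+ 3 / eta) by field; exact: lt0r_neq0.
have E3 : r ^+ 3 / (6 * eta) = 6^-1 * (r ^+ 3 / eta) by field; exact: lt0r_neq0.
have E4 : 2^-1 / eta * r ^+ 3 = 2^-1 * (r ^+ 3 / eta) by ring.
rewrite E1 E2 in h2; rewrite E4 in h5; rewrite E3.
move: h1 h2 h3 h4 h5; set B := r ^+ 3 / eta; set C := r ^+ 3.
by set D := e * r; set F := N * _; lra.
Qed.

(** Stationarity is tested along the new gradient itself. The weight 5/4 is 1/4 from the Taylor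
    remainder, 1/2 from the regularizer and 1/2 from splitting [N r] by Young. *)
Lemma grad_next_norm :
  euclid_norm (grad f (x + s)) <= 5 / 4 * (r ^+ 2 / eta) + e + 2^-1 * (eta * N ^+ 2).
Proof.
set w := grad f (x + s); set W := euclid_norm w.
have [W0|W0] := eqVneq W 0.
  rewrite W0; have := divr_ge0 (sqr_ge0 r) (ltW eta0).
  have := mulr_ge0 (ltW eta0) (sqr_ge0 N); have := e0; lra.
have Wp : 0 < W by rewrite lt_def W0 euclid_norm_ge0.
have h0 := cubic_first_order eta0 smin w; rewrite -/r in h0.
have h1 : dot w (w - grad f x - hess f x *m s) <= W * (L / 2 * r ^+ 2).
  apply: le_trans (dot_le _ _) _; rewrite ler_wpM2l ?(ltW Wp)//.
  exact: (grad_taylor_norm L0 f_C2 hess_lip x s).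
have h2 : dot w (grad f x) <= dot g w + W * e.
  rewrite (dotC w) -lerBlDl -dotNl -dotDl.
  by apply: le_trans (dot_le _ _) _; rewrite -(opprB g) euclid_normN mulrC.
have h3 : dot w (hess f x *m s) <= dot w (M *m s) + N * (W * r).
  rewrite -lerBlDl -dotNr -dotDr -mulNmx -mulmxDl.
  apply: le_trans (mulmx_dot_le _ _ _) _.
  by rewrite -(opprB M) frob_normN.
have h4 : dot s (hess f x *m w) <= dot s (M *m w) + N * (W * r).
  rewrite -lerBlDl -dotNr -dotDr -mulNmx -mulmxDl.
  apply: le_trans (mulmx_dot_le _ _ _) _.
  by rewrite -(opprB M) frob_normN (mulrC W).
have h5 : - dot s w <= r * W by rewrite -dotNl -[r]euclid_normN; exact: dot_le.
rewrite !dotDr !dotNr in h1.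
rewrite (hess_dotC f_C2 hess_lip w s x) in h4.
have h6 := ler_wpM2l (divr_ge0 r0 (ltW (mulr_gt0 (ltr0n R 2) eta0))) h5.
have h7 : L * r ^+ 2 <= 2^-1 / eta * r ^+ 2 by rewrite ler_wpM2r ?exprn_ge0// L_le_eta.
have h8 : 2 * (N * r) <= eta * N ^+ 2 + r ^+ 2 / eta.
  rewrite -subr_ge0.
  have -> : eta * N ^+ 2 + r ^+ 2 / eta - 2 * (N * r) = (eta * N - r) ^+ 2 / eta.
    by field; exact: lt0r_neq0.
  by rewrite divr_ge0 ?sqr_ge0// ltW.
have h9 := ler_wpM2l (ltW Wp) h7; have h10 := ler_wpM2l (ltW Wp) h8.
rewrite -(ler_pM2l Wp) -[W * W]expr2 -(dotvv w).
have E1 : r / (2 * eta) * (r * W) = 2^-1 * (W * (r ^+ 2 / eta)).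
  by field; exact: lt0r_neq0.
have E2 : W * (2^-1 / eta * r ^+ 2) = 2^-1 * (W * (r ^+ 2 / eta)) by ring.
rewrite E1 mulrN in h6; rewrite E2 in h9.
move: h0 h1 h2 h3 h4 h6 h9 h10.
lra.
Qed.


Lemma sqrt_cubeE (a : R) : 0 <= a -> a `^ (3 / 2) = Num.sqrt a ^+ 3.
Proof. by move=> a0; rewrite mulrC powRrM -powR12_sqrt// powR_mulrn ?powR_ge0. Qed.

(** The square roots [h] and [E] of [eta] and [e] make all exponents integers. The two error terms
    use up 1/300 and 1/15 of [r^3 / eta], and [1/6 - 1/300 - 1/15 > 1/11]. *)
Lemma newton_descent_young :
  f (x + s) + 11^-1 * (r ^+ 3 / eta)
  <= f x + 20 / 3 * Num.sqrt eta * e `^ (3 / 2) + 25 / 6 * eta ^+ 2 * N ^+ 3.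
Proof.
have h1 := newton_descent.
rewrite sqrt_cubeE//.
set h := Num.sqrt eta; set E := Num.sqrt e.
have hp : 0 < h by rewrite sqrtr_gt0.
have hE : eta = h ^+ 2 by rewrite sqr_sqrtr// ltW.
have E0 : 0 <= E by exact: sqrtr_ge0.
have eE : e = E ^+ 2 by rewrite sqr_sqrtr.
have h2 : e * r <= 20 / 3 * h * E ^+ 3 + 300^-1 * (r ^+ 3 / eta).
  have := young_sqrl (mulr_ge0 (mulr_ge0 (ler0n R 10) (ltW hp)) E0) r0.
  have p0 : 0 < (300 * h ^+ 2)^-1 by rewrite invr_gt0 mulr_gt0 ?ltr0n ?exprn_gt0.
  rewrite -(ler_pM2l p0) => H.
  apply: le_trans (_ : (300 * h ^+ 2)^-1 * (3 * ((10 * h * E) ^+ 2 * r)) <= _).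
    by rewrite eE; apply: le_of_eq; field; exact: lt0r_neq0.
  apply: le_trans H _.
  by rewrite hE; apply: le_of_eq; field; exact: lt0r_neq0.
have h3 : 2^-1 * (N * r ^+ 2) <= 15^-1 * (r ^+ 3 / eta) + 25 / 6 * eta ^+ 2 * N ^+ 3.
  have := young_sqrl r0 (mulr_ge0 (mulr_ge0 (ler0n R 5) (ltW eta0)) N0).
  have p0 : 0 < (30 * eta)^-1 by rewrite invr_gt0 mulr_gt0.
  rewrite -(ler_pM2l p0) => H.
  apply: le_trans (_ : (30 * eta)^-1 * (3 * (r ^+ 2 * (5 * eta * N))) <= _).
    by apply: le_of_eq; field; exact: lt0r_neq0.
  apply: le_trans H _.
  by apply: le_of_eq; field; exact: lt0r_neq0.
have E3 : r ^+ 3 / (6 * eta) = 6^-1 * (r ^+ 3 / eta) by field; exact: lt0r_neq0.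
have re0 : 0 <= r ^+ 3 / eta by rewrite divr_ge0 ?exprn_ge0// ltW.
rewrite E3 in h1; move: h1 h2 h3 re0.
set A := e * r; set B := N * _; set C := _ / eta; set D := _ * E ^+ 3.
set F := _ * N ^+ 3; lra.
Qed.

Lemma grad_next_powR :
  euclid_norm (grad f (x + s)) `^ (3 / 2)
  <= 25 / 12 * (r ^+ 3 / Num.sqrt eta ^+ 3) + 5 / 3 * e `^ (3 / 2)
     + 5 / 6 * (Num.sqrt eta ^+ 3 * N ^+ 3).
Proof.
rewrite !sqrt_cubeE ?euclid_norm_ge0//.
have hp : 0 < Num.sqrt eta by rewrite sqrtr_gt0.
rewrite -expr_div_n -exprMn; apply: weighted_cube_le; rewrite ?sqrtr_ge0//.
- by rewrite divr_ge0// ltW.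
- by rewrite mulr_ge0// ltW.
rewrite sqr_sqrtr ?euclid_norm_ge0// expr_div_n exprMn.
by rewrite (sqr_sqrtr (ltW eta0)) (sqr_sqrtr e0); exact: grad_next_norm.
Qed.

(** In the order of quadratic forms, [M + r / (2 eta) I >= 0]; replacing [M] by the Hessian at [x]
    costs [N], and moving to [x + s] costs [L r <= r / (2 eta)]. Hence
    [lambda_min >= - (r / eta + N)], which is then cubed. *)
Lemma lambda_min_next :
  - (4 * (r ^+ 3 / eta ^+ 3 + N ^+ 3)) <= lambda_min (hess f (x + s)) ^+ 3.
Proof.
have rn0 : 0 <= r / eta by rewrite divr_ge0// ltW.
have comb (D1 D2 D3 A1 A2 A3 : R) : D1 <= D2 + A3 -> D3 <= D1 + A2 ->
    0 <= D3 + 2^-1 * A1 -> A3 <= 2^-1 * A1 -> - (A1 + A2) <= D2 by lra.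
have lb : - (r / eta + N) <= lambda_min (hess f (x + s)).
  rewrite /lambda_min; set A := [set a | _].
  (* An empty set has infimum 0 by convention, and the bound is then trivial. *)
  have [->|A0] := eqVneq A set0; first by rewrite inf0 oppr_le0 addr_ge0.
  apply: lb_le_inf; first exact/set0P.
  move=> a /eigenvalueP[v vA v0].
  (* Eigenvectors are row vectors here, whereas [dot] takes columns. *)
  pose u := v^T.
  have up : 0 < dot u u.
    rewrite dotvv exprn_gt0// lt_def euclid_norm_ge0 andbT.
    apply: contraNneq v0 => /euclid_norm_eq0/(congr1 trmx).
    by rewrite trmxK trmx0 => ->.
  have hu : dot u (hess f (x + s) *m u) = a * dot u u.
    by rewrite /dot trmxK mulmxA vA -scalemxAl mxE.
  rewrite -(ler_pM2r up) -hu.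
  have h1 := hess_dot_le hess_lip u u (x + s) x.
  have h2 : dot u (M *m u) <= dot u (hess f x *m u) + N * dot u u.
    rewrite -lerBlDl -dotNr -dotDr -mulNmx -mulmxDl.
    by apply: le_trans (mulmx_dot_le _ _ _) _; rewrite dotvv -expr2.
  have h3 := cubic_second_order eta0 smin u; rewrite -/r in h3.
  have E1 : euclid_norm (x - (x + s)) = r.
    by rewrite opprD addrA subrr sub0r euclid_normN.
  rewrite E1 -expr2 -dotvv in h1.
  have h4 : L * r * dot u u <= 2^-1 / eta * r * dot u u.
    by rewrite ler_wpM2r ?(ltW up)// ler_wpM2r// L_le_eta.
  have E2 : r / (2 * eta) * dot u u = 2^-1 * (r / eta * dot u u).
    by field; exact: lt0r_neq0.
  have E3 : 2^-1 / eta * r * dot u u = 2^-1 * (r / eta * dot u u) by ring.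
  rewrite E2 in h3; rewrite E3 in h4.
  by rewrite mulNr mulrDl; exact: (comb _ _ _ _ _ _ h1 h2 h3 h4).
rewrite -expr_div_n; set p := r / eta in rn0 lb *.
have := cubeD_le rn0 N0; set l := lambda_min _ in lb *; set q := p + N in lb *.
have q0 : 0 <= q by rewrite addr_ge0.
move=> h; have [l0|l0] := leP 0 l.
  have := exprn_ge0 3 l0; have := exprn_ge0 3 q0.
  by move: h; set Q := q ^+ 3; set U := _ ^+ 3 + _; lra.
have : (- l) ^+ 3 <= q ^+ 3 by rewrite ler_pXn2r ?nnegrE//; lra.
rewrite exprNn -signr_odd/= expr1 mulN1r.
by move: h; set Q := q ^+ 3; set U := _ ^+ 3 + _; lra.
Qed.

End NewtonStep.

(** * Borel sets of matrices and independent samples *)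

Section MatrixBorel.
Context {R : realType}.

Lemma open_measurable_mx m n (U : set 'M[R]_(m, n)) : open U -> measurable U.
Proof. by move=> oU; exact: sub_sigma_algebra. Qed.

Lemma continuous_measurable_mx m n (g : 'M[R]_(m, n) -> R) :
  continuous g -> measurable_fun setT g.
Proof.
move=> /continuousP cg; apply: (measurability _ (RGenOpens.measurableE R)).
move=> _ [_ [a [b ->] <-]]; rewrite setTI; apply: open_measurable_mx.
exact/cg/interval_open.
Qed.

Lemma continuous_measurable_mx_mx m n p q (g : 'M[R]_(m, n) -> 'M[R]_(p, q)) :
  continuous g -> measurable_fun setT g.
Proof.
move=> /continuousP cg; apply: (measurability (@open 'M[R]_(p, q))) => //.
move=> _ [U oU <-]; rewrite setTI; apply: open_measurable_mx; exact: cg.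
Qed.

Lemma measurable_entry m n (i : 'I_m) (j : 'I_n) :
  measurable_fun setT (fun A : 'M[R]_(m, n) => A i j).
Proof. by apply: continuous_measurable_mx => A; exact: coord_continuous. Qed.

(* An open set is a countable union of rational boxes. *)
Lemma measurable_mx d (T : measurableType d) m n (h : T -> 'M[R]_(m, n)) :
  (forall i j, measurable_fun setT (fun t => h t i j)) -> measurable_fun setT h.
Proof.
move=> mh; apply: (measurability (@open 'M[R]_(m, n))) => //.
move=> _ [U oU <-]; rewrite setTI.
pose Q := ('M[rat]_(m, n) * rat)%type.
pose box (q : Q) : set 'M[R]_(m, n) :=
  [set A | forall i j, `|A i j - ratr (q.1 i j)| < ratr q.2].
have -> : h @^-1` U = \bigcup_(q in [set: Q])
    (if `[< box q `<=` U >] then h @^-1` box q else set0).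
  apply/seteqP; split => t /=; last first.
    by move=> [q _]; case: asboolP => // qU /qU.
  move=> Ut; have /nbhs_ballP[e /= e0 eU] : nbhs (h t) U by apply: open_nbhs_nbhs; split.
  (* In a box of radius [r < e / 2] any two points have entries less than [e] apart. *)
  have [r] := rat_in_itvoo (divr_gt0 e0 (ltr0n R 2)); rewrite in_itv/= => /andP[r0 r1].
  have ex i j : {q : rat | `|h t i j - ratr q| < ratr r}.
    apply: cid; have [q] := @rat_in_itvoo R (h t i j - ratr r) (h t i j + ratr r) ltac:(lra).
    by rewrite in_itv/= => qP; exists q; rewrite ltr_norml; lra.
  exists (\matrix_(i, j) sval (ex i j), r) => //.
  have hb : box (\matrix_(i, j) sval (ex i j), r) (h t).
    by move=> i j; rewrite /= mxE; exact: (svalP (ex i j)).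
  case: asboolP => // -[]; move=> A hA; apply: eU; split => // i j.
  have := hA i j; have := hb i j; rewrite /= mxE => h1 h2.
  rewrite /ball/=; rewrite (_ : h t i j - A i j
    = (h t i j - ratr (sval (ex i j))) - (A i j - ratr (sval (ex i j)))); last by ring.
  by apply: le_lt_trans (ler_normB _ _) _; lra.
apply: countable_bigcupT_measurable => [|q]; first exact: countableP.
case: asboolP => // _.
have -> : h @^-1` box q = \bigcap_(p in [set: 'I_m * 'I_n])
    [set t | `|h t p.1 p.2 - ratr (q.1 p.1 p.2)| < ratr q.2].
  apply/seteqP; split => t /= ht; first by move=> p _; exact: ht.
  by move=> i j; exact: (ht (i, j)).
apply: fin_bigcap_measurable; first exact: finite_finset.
move=> [i j] _ /=; rewrite -[X in measurable X]setTI.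
apply: (@measurable_fun_ltr _ _ _ setT (fun t => `|h t i j - ratr (q.1 i j)|)
   (cst (ratr q.2)) _ _ measurableT [set true]) => //.
by apply: measurableT_comp => //; apply: measurable_funB.
Qed.

Lemma measurable_mxD d (T : measurableType d) m n (g h : T -> 'M[R]_(m, n)) :
  measurable_fun setT g -> measurable_fun setT h ->
  measurable_fun setT (fun t => g t + h t).
Proof.
move=> mg mh; apply: measurable_mx => i j.
under eq_fun do rewrite mxE.
by apply: measurable_funD; apply: (measurableT_comp (measurable_entry i j)).
Qed.

Lemma measurable_mxZ d (T : measurableType d) m n (c : R) (h : T -> 'M[R]_(m, n)) :
  measurable_fun setT h -> measurable_fun setT (fun t => c *: h t).
Proof.
move=> mh; apply: measurable_mx => i j.
under eq_fun do rewrite mxE.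
by apply: measurable_funM => //; apply: (measurableT_comp (measurable_entry i j)).
Qed.

Lemma measurable_mxB d (T : measurableType d) m n (g h : T -> 'M[R]_(m, n)) :
  measurable_fun setT g -> measurable_fun setT h ->
  measurable_fun setT (fun t => g t - h t).
Proof.
move=> mg mh; under eq_fun do rewrite -scaleN1r.
by apply: measurable_mxD => //; exact: measurable_mxZ.
Qed.

Lemma measurable_frob_norm d (T : measurableType d) m n (h : T -> 'M[R]_(m, n)) :
  measurable_fun setT h -> measurable_fun setT (fun t => frob_norm (h t)).
Proof.
move=> mh; apply: (measurableT_comp (continuous_measurable_fun (@sqrt_continuous R))).
apply: measurable_sum => i; apply: measurable_sum => j.
by apply: measurable_funX; apply: (measurableT_comp (measurable_entry i j)).
Qed.

Lemma measurable_euclid_norm d (T : measurableType d) n (h : T -> 'cV[R]_n) :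
  measurable_fun setT h -> measurable_fun setT (fun t => euclid_norm (h t)).
Proof.
move=> mh; apply: (measurableT_comp (continuous_measurable_fun (@sqrt_continuous R))).
apply: measurable_sum => i.
by apply: measurable_funX; apply: (measurableT_comp (measurable_entry i ord0)).
Qed.

End MatrixBorel.

(** * Integrating out a fresh sample *)

Section Freezing.
Context {R : realType} {dO d1 d2 : measure_display}.
Context {Omega : measurableType dO} {T1 : measurableType d1} {T2 : measurableType d2}.
Variables (P : probability Omega R) (W : {RV P >-> T1}) (Y : {RV P >-> T2}).
Hypothesis WY : forall A B, measurable A -> measurable B ->
  P (W @^-1` A `&` Y @^-1` B) = (P (W @^-1` A) * P (Y @^-1` B))%E.

(** By [WY] the joint law of [W] and [Y] agrees with the product of their laws on rectangles, hence
    everywhere; Tonelli's theorem does the rest. *)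
Lemma integral_indep (phi : T1 * T2 -> \bar R) :
  measurable_fun setT phi -> (forall p, 0 <= phi p)%E ->
  (\int[P]_w phi (W w, Y w) =
   \int[P]_w \int[distribution P Y]_y phi (W w, y))%E.
Proof.
move=> mphi phi0.
have mWY : measurable_fun setT (fun w => (W w, Y w)).
  by apply: measurable_fun_pair.
transitivity (\int[pushforward P (fun w => (W w, Y w))]_p phi p)%E.
  by rewrite ge0_integral_pushforward.
transitivity (\int[distribution P W \x distribution P Y]_p phi p)%E.
  apply: eq_measure_integral => A mA _ /=; apply/esym.
  apply: (@product_measure_unique _ _ _ _ _ _ _ (pushforward P (fun w => (W w, Y w)))) => //.
rewrite (fubini_tonelli1 phi mphi phi0).
rewrite (@ge0_integral_pushforward _ _ _ _ _ W)//.
- exact: measurable_fun_fubini_tonelli_F.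
- by move=> t _; exact: integral_ge0.
Qed.

End Freezing.

(** This stands in for conditional expectation: [W] collects what is known from the past [F], and
    only the fresh [Y] is averaged. *)
Lemma integral_fresh {R : realType} {dO d1 d2 : measure_display}
  {Omega : measurableType dO} {T1 : measurableType d1} {T2 : measurableType d2}
  (P : probability Omega R) (Q : probability T2 R) (F : set (set Omega))
  (W : Omega -> T1) (Y : {RV P >-> T2}) (phi : T1 * T2 -> \bar R) :
  (forall A, F A -> measurable A) ->
  (forall A, measurable A -> F (W @^-1` A)) ->
  independent_of P F Y ->
  (forall B, measurable B -> distribution P Y B = Q B) ->
  measurable_fun setT phi -> (forall p, 0 <= phi p)%E ->
  (\int[P]_w phi (W w, Y w) = \int[P]_w \int[Q]_y phi (W w, y))%E.
Proof.
move=> mF mW ind lawY mphi phi0.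
have mW' : measurable_fun setT W by move=> _ A mA; rewrite setTI; exact/mF/mW.
pose Wm : {mfun Omega >-> T1} := mfun_Sub (mem_set mW').
have := @integral_indep _ _ _ _ _ _ _ P Wm Y _ phi mphi phi0.
rewrite /Wm/= => -> //; last first.
  by move=> A B mA mB; apply: ind => //; exact: mW.
apply: eq_integral => w _; apply: eq_measure_integral => A mA _.
exact: lawY.
Qed.

Lemma integral_fresh_le {R : realType} {dO d1 d2 : measure_display}
  {Omega : measurableType dO} {T1 : measurableType d1} {T2 : measurableType d2}
  (P : probability Omega R) (Q : probability T2 R) (F : set (set Omega))
  (W : Omega -> T1) (Y : {RV P >-> T2}) (phi : T1 * T2 -> R) (g : Omega -> R) :
  (forall A, F A -> measurable A) ->
  (forall A, measurable A -> F (W @^-1` A)) ->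
  independent_of P F Y ->
  (forall B, measurable B -> distribution P Y B = Q B) ->
  measurable_fun setT phi -> (forall p, 0 <= phi p) ->
  measurable_fun setT g ->
  (forall w, (\int[Q]_y (phi (W w, y))%:E <= (g w)%:E)%E) ->
  (\int[P]_w (phi (W w, Y w))%:E <= \int[P]_w (g w)%:E)%E.
Proof.
move=> mF mW ind lawY mphi phi0 mg hle.
have mphi' : measurable_fun setT (EFin \o phi) by exact/measurable_EFinP.
have phi0' p : (0 <= (EFin \o phi) p)%E by rewrite lee_fin.
have := integral_fresh mF mW ind lawY mphi' phi0' => /= ->.
have mW' : measurable_fun setT W by move=> _ A mA; rewrite setTI; exact/mF/mW.
apply: ge0_le_integral => //.
- by move=> w _; apply: integral_ge0 => y _; rewrite lee_fin.
- have mI := measurable_fun_fubini_tonelli_F (m2 := Q) _ mphi' phi0'.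
  exact: (measurableT_comp mI mW').
- exact/measurable_EFinP.
Qed.

(** * The error of the momentum estimator *)

(** A nonnegative integral is a supremum over the simple functions below the integrand, so it is
    monotone even for integrands whose measurability is not established, such as those evaluated at
    the random index. *)
Lemma ge0_le_integral_nonmeasurable {R : realType} d (T : measurableType d)
    (mu : measure T R) (g h : T -> \bar R) :
  (forall t, 0 <= g t)%E -> (forall t, g t <= h t)%E ->
  (\int[mu]_t g t <= \int[mu]_t h t)%E.
Proof.
move=> g0 gh; have h0 t : (0 <= h t)%E by exact: le_trans (gh t).
rewrite !ge0_integralE// !patch_setT.
apply: le_ereal_sup => _ [s /= sg <-]; exists s => //= t.
exact: le_trans (sg t) (gh t).
Qed.

Lemma ge0_integral_lin {R : realType} {d : measure_display} {T : measurableType d}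
    (mu : measure T R) (a b : R) (g h : T -> R) :
  measurable_fun setT g -> measurable_fun setT h ->
  (forall t, 0 <= g t) -> (forall t, 0 <= h t) -> 0 <= a -> 0 <= b ->
  (\int[mu]_t (a * g t + b * h t)%:E
   = a%:E * \int[mu]_t (g t)%:E + b%:E * \int[mu]_t (h t)%:E)%E.
Proof.
move=> mg mh g0 h0 a0 b0.
rewrite -!ge0_integralZl_EFin//; last 4 first.
- by move=> t _; rewrite lee_fin.
- exact/measurable_EFinP.
- by move=> t _; rewrite lee_fin.
- exact/measurable_EFinP.
rewrite -ge0_integralD//.
- by move=> t _; rewrite -EFinM lee_fin mulr_ge0.
- by apply/measurable_EFinP; exact: measurable_funM.
- by move=> t _; rewrite -EFinM lee_fin mulr_ge0.
- by apply/measurable_EFinP; exact: measurable_funM.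
Qed.

Section Centered.
Context {R : realType} {d : measure_display} {T : measurableType d}.
Variable P : probability T R.

Lemma integral_probability_cst (c : \bar R) : (\int[P]_t c = c)%E.
Proof.
rewrite (integral_cst P measurableT c) -[RHS]mule1.
by congr (_ * _)%E; exact: probability_setT.
Qed.

Definition centered (h : T -> R) : Prop :=
  P.-integrable setT (EFin \o h) /\ (\int[P]_t (h t)%:E = 0)%E.

Lemma centeredD (g h : T -> R) :
  centered g -> centered h -> centered (fun t => g t + h t).
Proof.
move=> [ig g0] [ih h0]; split; first exact: (integrableD measurableT ig ih).
under eq_integral do rewrite EFinD.
by rewrite (integralD measurableT ig ih) g0 h0 adde0.
Qed.

Lemma centeredZ (c : R) (h : T -> R) : centered h -> centered (fun t => c * h t).
Proof.
move=> [ih h0]; split; first exact: (integrableZl measurableT c ih).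
under eq_integral do rewrite EFinM.
by rewrite (integralZl measurableT ih) h0 mule0.
Qed.

Lemma centered_sum (I : Type) (s : seq I) (h : I -> T -> R) :
  (forall i, centered (h i)) -> centered (fun t => \sum_(i <- s) h i t).
Proof.
move=> ch; elim: s => [|i s ih].
  under eq_fun do rewrite big_nil; split; last by rewrite integral0.
  exact: integrable0.
by under eq_fun do rewrite big_cons; exact: centeredD.
Qed.

(** The bound contains a term [l] without sign, so it must be split by integrability; for [k] this
    comes from the finite bound [K]. *)
Lemma integral_le_centered (h k l : T -> R) (c K : R) :
  measurable_fun setT h -> measurable_fun setT k -> centered l ->
  (forall t, 0 <= h t) -> (forall t, 0 <= k t) -> 0 <= c ->
  (forall t, h t <= c + l t + k t) ->
  (\int[P]_t (k t)%:E <= K%:E)%E ->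
  (\int[P]_t (h t)%:E <= (c + K)%:E)%E.
Proof.
move=> mh mk [il l0] h0 k0 c0 hle kK.
have ml : measurable_fun setT l by exact/measurable_EFinP/(measurable_int _ il).
have ick : P.-integrable setT (EFin \o (fun t => c + k t)).
  apply: (@integrableD _ _ _ P setT measurableT (EFin \o cst c) (EFin \o k)).
    by apply: finite_measure_integrable_cst.
  apply/integrableP; split; first exact/measurable_EFinP.
  under eq_integral do rewrite /= ger0_norm//.
  exact: le_lt_trans kK (ltry _).
apply: (@le_trans _ _ (\int[P]_t ((c + k t)%:E + (l t)%:E))%E).
  apply: ge0_le_integral => //.
  - by move=> t _; rewrite lee_fin.
  - exact/measurable_EFinP.
  - by apply/measurable_EFinP/measurable_funD => //; exact: measurable_funD.
  - by move=> t _; rewrite -EFinD lee_fin; have := hle t; lra.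
rewrite (integralD measurableT ick il) l0 adde0.
under eq_integral do rewrite /= EFinD.
rewrite ge0_integralD//; last 2 first.
- by move=> t _; rewrite lee_fin.
- exact/measurable_EFinP.
by rewrite integral_probability_cst EFinD leeD2l.
Qed.

End Centered.

Section MomentumStep.
Context {R : realType} {n : nat} {dXi : measure_display} {Xi : measurableType dXi}.
Variables (PXi : probability Xi R) (f : 'cV[R]_n -> R) (H : 'cV[R]_n -> Xi -> 'M[R]_n).
Variables (L_F sigma L_H : R).
Hypothesis L_F0 : 0 < L_F.
Hypothesis lipF : forall x y,
  frob_norm (hess f y - hess f x) <= L_F * euclid_norm (y - x).
Hypothesis mH : forall x, measurable_fun setT (H x).
Hypothesis H_unbiased : forall x i j,
  (\int[PXi]_xi (H x xi i j)%:E = (hess f x i j)%:E)%E.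
Hypothesis H_error : forall x,
  (\int[PXi]_xi (frob_norm (H x xi - hess f x) ^+ 3)%:E <= (sigma ^+ 3)%:E)%E.
Hypothesis H_smooth : forall x y,
  (\int[PXi]_xi (frob_norm (H y xi - H x xi) ^+ 3)%:E
   <= (L_H ^+ 3 * euclid_norm (y - x) ^+ 3)%:E)%E.

Lemma mx_convex_split m p (c : R) (u v : 'M[R]_(m, p)) :
  u - (1 - c) *: v = c *: u + (1 - c) *: (u - v).
Proof. by apply/matrixP => i j; rewrite !mxE; ring. Qed.

Lemma mx_regroup m p (a b c e : 'M[R]_(m, p)) :
  (a - b) - (c - e) = (a - c) + - (b - e).
Proof. by apply/matrixP => i j; rewrite !mxE; ring. Qed.

(** Here the correction term of the recursion pays off: the old error is contracted, and the
    remainder is a difference of estimation errors, which is centered. *)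
Lemma mx_momentum_error m p (c : R) (a b e u v : 'M[R]_(m, p)) :
  c *: a + u - c *: v - b = c *: (a - e) + ((u - b) - c *: (v - e)).
Proof. by apply/matrixP => i j; rewrite !mxE; ring. Qed.

Lemma mx_subZ_entry m p (c : R) (u v : 'M[R]_(m, p)) i j :
  (u - c *: v) i j = u i j + - c * v i j.
Proof. by rewrite !mxE mulNr. Qed.

Lemma entry_le_frob m p (A : 'M[R]_(m, p)) i j : `|A i j| <= frob_norm A.
Proof.
rewrite -(@ler_pXn2r _ 2)// ?nnegrE ?frob_norm_ge0// frob_normE sqr_l2.
rewrite real_normK ?num_real// (bigD1 (i, j))//= lerDl.
by apply: sumr_ge0 => k _; exact: sqr_ge0.
Qed.

Lemma centered_error x i j : centered PXi (fun xi => (H x xi - hess f x) i j).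
Proof.
have mE : measurable_fun setT (fun xi => (H x xi - hess f x) i j).
  apply: (measurableT_comp (measurable_entry i j)).
  exact: measurable_mxB.
have mN : measurable_fun setT (fun xi => frob_norm (H x xi - hess f x) ^+ 3).
  by apply: measurable_funX; apply: measurable_frob_norm; exact: measurable_mxB.
have iE : PXi.-integrable setT (EFin \o fun xi => (H x xi - hess f x) i j).
  apply/integrableP; split; first exact/measurable_EFinP.
  apply: (@le_lt_trans _ _ (1 + (sigma ^+ 3)%:E)%E); last by rewrite -EFinD ltry.
  (* The first moment is finite because the third one is: [a <= 1 + a^3] for [a >= 0]. *)
  apply: (@le_trans _ _ (\int[PXi]_xi (1 + (frob_norm (H x xi - hess f x) ^+ 3)%:E))%E).
    apply: ge0_le_integral => //=.
    - by apply/measurable_EFinP; apply: measurableT_comp.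
    - by apply: emeasurable_funD => //; exact/measurable_EFinP.
    - move=> xi _; rewrite -EFinD lee_fin; apply: le_trans (entry_le_frob _ _ _) _.
      have := frob_norm_ge0 (H x xi - hess f x); set a := frob_norm _ => a0.
      have [a1|a1] := leP a 1.
        by apply: le_trans a1 _; rewrite lerDl exprn_ge0.
      have : a ^+ 1 <= a ^+ 3 by rewrite ler_weXn2l// ltW.
      by rewrite expr1 => h; apply: le_trans h _; rewrite lerDr.
  rewrite ge0_integralD//; last 2 first.
  - by move=> xi _; rewrite lee_fin exprn_ge0 ?frob_norm_ge0.
  - exact/measurable_EFinP.
  by rewrite integral_probability_cst leeD2l.
split => //.
have iC : PXi.-integrable setT (EFin \o cst (hess f x i j)).
  exact: finite_measure_integrable_cst.
have := integralD measurableT iE iC.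
under eq_integral do rewrite /= !mxE -EFinD subrK.
rewrite H_unbiased.
have -> : (\int[PXi]_xi (EFin \o cst (hess f x i j)) xi = (hess f x i j)%:E)%E.
  exact: (integral_probability_cst PXi (hess f x i j)%:E).
have /fineK <- := integrable_fin_num measurableT iE.
by rewrite -EFinD => -[] h; congr (_%:E); move: h; rewrite /=; lra.
Qed.

Variables (theta : R) (B : 'M[R]_n) (x y : 'cV[R]_n).
Hypothesis theta01 : 0 < theta < 1.
Let q := Num.sqrt theta.

(** Let [A = (1 - theta) N]. Young with scale [7/5 q] absorbs [3 A b^2] at the cost of a factor
    [1 + (49/25) theta] on [A^3]. As 49/25 < 2, two of the three factors [1 - theta] pay for it and
    one survives. On [b^3 / q] the total is [10/7 + 1 <= 5/2]. *)
Lemma cube_sum_weighted (N b : R) : 0 <= N -> 0 <= b ->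
  ((1 - theta) * N) ^+ 3 + 3 * ((1 - theta) * N) * b ^+ 2 + b ^+ 3
  <= (1 - theta) * N ^+ 3 + 5 / (2 * q) * b ^+ 3.
Proof.
move=> N0 b0; case/andP: theta01 => t0 t1.
have q0 : 0 < q by rewrite sqrtr_gt0.
have q2 : theta = q ^+ 2 by rewrite sqr_sqrtr// ltW.
have q1 : q <= 1 by rewrite -(@ler_pXn2r _ 2) ?nnegrE ?(ltW q0)// expr1n -q2 (ltW t1).
set A := (1 - theta) * N.
have A0 : 0 <= A by rewrite mulr_ge0//; lra.
have h1 : 3 * A * b ^+ 2 <= 10 / 7 * (b ^+ 3 / q) + 49 / 25 * (theta * A ^+ 3).
  have := young_sqrl b0 (mulr_ge0 (mulr_ge0 (_ : 0 <= 7 / 5) (ltW q0)) A0).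
  move=> /(_ ltac:(lra)); have p0 : 0 < (7 / 5 * q)^-1 by rewrite invr_gt0 mulr_gt0.
  rewrite -(ler_pM2l p0) => h.
  apply: le_trans (_ : (7 / 5 * q)^-1 * (3 * (b ^+ 2 * (7 / 5 * q * A))) <= _).
    by apply: le_of_eq; field; exact: lt0r_neq0.
  apply: le_trans h _.
  by rewrite q2; apply: le_of_eq; field; exact: lt0r_neq0.
have h2 : b ^+ 3 <= b ^+ 3 / q.
  by rewrite ler_pdivlMr// ler_piMr// exprn_ge0.
have h3 : A ^+ 3 * (1 + 49 / 25 * theta) <= (1 - theta) * N ^+ 3.
  have -> : A ^+ 3 * (1 + 49 / 25 * theta)
     = (1 - theta) * N ^+ 3 * ((1 - theta) ^+ 2 * (1 + 49 / 25 * theta)).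
    by rewrite /A; ring.
  rewrite ler_piMr//; first by rewrite mulr_ge0 ?exprn_ge0//; lra.
  rewrite -subr_ge0.
  have -> : 1 - (1 - theta) ^+ 2 * (1 + 49 / 25 * theta)
    = theta * (25^-1 + 49 / 25 * (theta * (1 - theta)) + 24 / 25 * theta) by field.
  by rewrite mulr_ge0 ?(ltW t0)// !addr_ge0// ?mulr_ge0// ?mulr_ge0//; lra.
have h4 : 0 <= b ^+ 3 / q by rewrite divr_ge0 ?exprn_ge0// ltW.
have -> : 5 / (2 * q) * b ^+ 3 = 5 / 2 * (b ^+ 3 / q) by field; exact: lt0r_neq0.
move: h1 h2 h3 h4; set U := b ^+ 3 / q; set V := 3 * A * _.
by rewrite (mulrDr (A ^+ 3)) mulr1 (mulrC (A ^+ 3)) -mulrA; lra.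
Qed.

Let noise xi : 'M[R]_n :=
  (H y xi - hess f y) - (1 - theta) *: (H x xi - hess f x).

(** Both parts of [theta *: u + (1 - theta) *: (u - v)] are small: the first carries [theta], and
    the second compares two points under the same sample. Two uses of [cubeD_le] give the factors 4
    and 16. *)
Lemma noise_cube_le xi : frob_norm (noise xi) ^+ 3 <=
  4 * theta ^+ 3 * frob_norm (H y xi - hess f y) ^+ 3
  + 16 * frob_norm (H y xi - H x xi) ^+ 3 + 16 * L_F ^+ 3 * euclid_norm (y - x) ^+ 3.
Proof.
case/andP: theta01 => t0 t1.
set u := H y xi - hess f y; set v := H x xi - hess f x.
have -> : noise xi = theta *: u + (1 - theta) *: (u - v).
  exact: mx_convex_split.
have uv : u - v = (H y xi - H x xi) + - (hess f y - hess f x).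
  exact: mx_regroup.
have h1 : frob_norm (theta *: u + (1 - theta) *: (u - v))
    <= theta * frob_norm u + frob_norm (u - v).
  apply: le_trans (frob_normD _ _) _; rewrite !frob_normZ (gtr0_norm t0).
  rewrite lerD2l ger0_norm; last lra.
  by rewrite ler_piMl ?frob_norm_ge0//; lra.
have h2 : frob_norm (u - v) <= frob_norm (H y xi - H x xi) + L_F * euclid_norm (y - x).
  rewrite uv; apply: le_trans (frob_normD _ _) _.
  by rewrite frob_normN lerD2l.
have h3 : frob_norm (u - v) ^+ 3 <= 4 * (frob_norm (H y xi - H x xi) ^+ 3
   + (L_F * euclid_norm (y - x)) ^+ 3).
  apply: le_trans (cubeD_le (frob_norm_ge0 _) _); last first.
    by rewrite mulr_ge0 ?euclid_norm_ge0// ltW.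
  rewrite ler_pXn2r// nnegrE ?frob_norm_ge0// addr_ge0 ?frob_norm_ge0//.
  by rewrite mulr_ge0 ?euclid_norm_ge0// ltW.
apply: (@le_trans _ _ ((theta * frob_norm u + frob_norm (u - v)) ^+ 3)).
  rewrite ler_pXn2r// nnegrE ?frob_norm_ge0// addr_ge0 ?frob_norm_ge0//.
  by rewrite mulr_ge0 ?frob_norm_ge0// ltW.
apply: le_trans (cubeD_le _ (frob_norm_ge0 _)) _.
  by rewrite mulr_ge0 ?frob_norm_ge0// ltW.
rewrite !exprMn in h3 *; move: h3.
set a := frob_norm (u - v) ^+ 3; set b := frob_norm (H y xi - H x xi) ^+ 3.
set c := L_F ^+ 3 * _; set e := frob_norm u ^+ 3.
by rewrite -!(mulrA 16) -/c -!mulrA; lra.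
Qed.

Let Merr xi : 'M[R]_n :=
  (1 - theta) *: B + H y xi - (1 - theta) *: H x xi - hess f y.

Lemma momentum_cube_le xi : frob_norm (Merr xi) ^+ 3 <=
  (1 - theta) * frob_norm (B - hess f x) ^+ 3
  + 3 * ((1 - theta) * frob_norm (B - hess f x)) *
     (\sum_p ((1 - theta) * (B - hess f x) p.1 p.2) * noise xi p.1 p.2)
  + 5 / (2 * q) * frob_norm (noise xi) ^+ 3.
Proof.
case/andP: theta01 => t0 t1.
set E := B - hess f x.
have -> : Merr xi = (1 - theta) *: E + noise xi.
  exact: mx_momentum_error.
have := cube_l2D (fun p : 'I_n * 'I_n => ((1 - theta) *: E) p.1 p.2)
  (fun p => noise xi p.1 p.2).
rewrite -!frob_normE.
have -> : l2 (fun p : 'I_n * 'I_n => ((1 - theta) *: E) p.1 p.2 + noise xi p.1 p.2)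
   = frob_norm ((1 - theta) *: E + noise xi).
  by rewrite frob_normE; congr l2; apply/funext => p; rewrite [RHS]mxE.
rewrite frob_normZ ger0_norm; last lra.
under eq_bigr do rewrite mxE.
have := cube_sum_weighted (frob_norm_ge0 E) (frob_norm_ge0 (noise xi)).
set a := frob_norm E; set b := frob_norm _; set S := \sum_p _.
set Z := frob_norm _ ^+ 3; set bb := 5 / (2 * q) * _; set w := 3 * _ * S.
set bc := b ^+ 3; set ww := 3 * _ * b ^+ 2; set aa := (_ * a) ^+ 3; set ac := _ * a ^+ 3.
by lra.
Qed.

Lemma integral_momentum_step :
  (\int[PXi]_xi (frob_norm (Merr xi) ^+ 3)%:E <=
   ((1 - theta) * frob_norm (B - hess f x) ^+ 3 + 10 * theta ^+ 3 / q * sigma ^+ 3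
    + 40 / q * (L_F ^+ 3 + L_H ^+ 3) * euclid_norm (y - x) ^+ 3)%:E)%E.
Proof.
case/andP: (theta01) => t0 t1.
have q0 : 0 < q by rewrite sqrtr_gt0.
set r := euclid_norm (y - x).
have r0 : 0 <= r by exact: euclid_norm_ge0.
(* The integrand is at most [c + l + k]: [c] is deterministic, [l] is the cross term, linear in the
   noise and hence centered, and [k] has integral at most [K]. The constants 10 and 40 are 4 and 16
   times 5/2. *)
pose c := (1 - theta) * frob_norm (B - hess f x) ^+ 3 + 40 / q * (L_F ^+ 3 * r ^+ 3).
pose k xi := 10 * theta ^+ 3 / q * frob_norm (H y xi - hess f y) ^+ 3
  + 40 / q * frob_norm (H y xi - H x xi) ^+ 3.
pose K := 10 * theta ^+ 3 / q * sigma ^+ 3 + 40 / q * (L_H ^+ 3 * r ^+ 3).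
pose l xi := 3 * ((1 - theta) * frob_norm (B - hess f x)) *
     (\sum_p ((1 - theta) * (B - hess f x) p.1 p.2) * noise xi p.1 p.2).
have c1 : 0 <= 10 * theta ^+ 3 / q.
  by apply: divr_ge0; rewrite ?(ltW q0)// mulr_ge0 ?exprn_ge0// ltW.
have c2 : 0 <= 40 / q by rewrite divr_ge0// ltW.
have mHd z (w : 'M[R]_n) : measurable_fun setT (fun xi => frob_norm (H z xi - w) ^+ 3).
  by apply: measurable_funX; apply: measurable_frob_norm; exact: measurable_mxB.
have mHH : measurable_fun setT (fun xi => frob_norm (H y xi - H x xi) ^+ 3).
  by apply: measurable_funX; apply: measurable_frob_norm; exact: measurable_mxB.
have -> : (1 - theta) * frob_norm (B - hess f x) ^+ 3 + 10 * theta ^+ 3 / q * sigma ^+ 3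
    + 40 / q * (L_F ^+ 3 + L_H ^+ 3) * r ^+ 3 = c + K by rewrite /c /K; ring.
apply: (@integral_le_centered _ _ _ PXi _ k l).
- apply: measurable_funX; apply: measurable_frob_norm.
  do 2!apply: measurable_mxB => //; last exact: measurable_mxZ.
  by apply: measurable_mxD => //; exact: measurable_mxZ.
- by apply: measurable_funD; apply: measurable_funM.
- apply: centeredZ; apply: centered_sum => p; apply: centeredZ.
  have := centeredD (centered_error y p.1 p.2)
    (centeredZ (- (1 - theta)) (centered_error x p.1 p.2)).
  by congr centered; apply/funext => xi; rewrite [RHS]mx_subZ_entry.
- by move=> xi; rewrite exprn_ge0 ?frob_norm_ge0.
- by move=> xi; rewrite addr_ge0// mulr_ge0// exprn_ge0 ?frob_norm_ge0.
- rewrite addr_ge0// mulr_ge0// ?exprn_ge0 ?frob_norm_ge0//; first lra.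
  by rewrite mulr_ge0// exprn_ge0// ltW.
- move=> xi; apply: le_trans (momentum_cube_le xi) _; rewrite -/(l xi).
  have h := noise_cube_le xi; rewrite -/r in h.
  have p0 : 0 <= 5 / (2 * q) by rewrite divr_ge0// mulr_ge0// ltW.
  have := ler_wpM2l p0 h.
  have -> : 5 / (2 * q) * (4 * theta ^+ 3 * frob_norm (H y xi - hess f y) ^+ 3 +
     16 * frob_norm (H y xi - H x xi) ^+ 3 + 16 * L_F ^+ 3 * r ^+ 3)
    = k xi + 40 / q * (L_F ^+ 3 * r ^+ 3).
    by rewrite /k; field; exact: lt0r_neq0.
  rewrite /c; set A1 := _ * _ ^+ 3; set A2 := 40 / q * (L_F ^+ 3 * _).
  by set A3 := (1 - theta) * _; set A4 := l xi; set A5 := k xi; lra.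
rewrite /k ge0_integral_lin//; last 2 first.
- by move=> xi; rewrite exprn_ge0 ?frob_norm_ge0.
- by move=> xi; rewrite exprn_ge0 ?frob_norm_ge0.
rewrite /K EFinD (EFinM _ (sigma ^+ 3)) (EFinM _ (L_H ^+ 3 * _)).
by apply: leeD; apply: lee_wpmul2l; rewrite ?lee_fin.
Qed.

End MomentumStep.

(** * Adapted processes and the random index *)

Section Adapted.
Context {R : realType} {n : nat} {dZ dXi dO : measure_display}.
Context {Z : measurableType dZ} {Xi : measurableType dXi} {Omega : measurableType dO}.

Definition adapted (F : set (set Omega)) d (T : measurableType d) (h : Omega -> T) :=
  forall A, measurable A -> F (h @^-1` A).

(** Over the type carrying the generated sigma-algebra, being adapted is plain measurability, so the
    closure lemmas for measurable functions apply. *)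
Lemma adapted_measurable (S : set (set Omega)) d (T : measurableType d) (h : Omega -> T) :
  adapted <<s S>> h <-> measurable_fun [set: g_sigma_algebraType S] h.
Proof.
split=> [ah _ A mA | mh A mA]; first by rewrite setTI; exact: ah.
by rewrite -[X in <<s S>> X]setTI; exact: mh.
Qed.

Lemma adapted_comp (S : set (set Omega)) d1 d2 (T1 : measurableType d1)
    (T2 : measurableType d2) (g : T1 -> T2) (h : Omega -> T1) :
  measurable_fun setT g -> adapted <<s S>> h -> adapted <<s S>> (g \o h).
Proof.
move=> mg /adapted_measurable mh; apply/adapted_measurable.
exact: (measurableT_comp mg mh).
Qed.

Lemma adapted_pair (S : set (set Omega)) d1 d2 (T1 : measurableType d1)
    (T2 : measurableType d2) (g : Omega -> T1) (h : Omega -> T2) :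
  adapted <<s S>> g -> adapted <<s S>> h -> adapted <<s S>> (fun w => (g w, h w)).
Proof.
move=> /adapted_measurable mg /adapted_measurable mh; apply/adapted_measurable.
exact: (measurable_fun_pair mg mh).
Qed.

Lemma adapted_momentum (S : set (set Omega)) (H : 'cV[R]_n -> Xi -> 'M[R]_n)
    (theta : nat -> R) (x : nat -> Omega -> 'cV[R]_n) (xi : nat -> Omega -> Xi) k :
  measurable_fun [set: 'cV[R]_n * Xi] (fun p => H p.1 p.2) ->
  (forall j, (j <= k)%N -> adapted <<s S>> (x j)) ->
  (forall j, (j <= k)%N -> adapted <<s S>> (xi j)) ->
  adapted <<s S>> (momentum_hess H theta x xi k).
Proof.
move=> mH; elim: k => [|k IH] ax axi.
  exact: (adapted_comp mH (adapted_pair (ax 0%N isT) (axi 0%N isT))).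
have {}IH : adapted <<s S>> (momentum_hess H theta x xi k).
  by apply: IH => j jk; [apply: ax; exact: leqW|apply: axi; exact: leqW].
have a1 := adapted_comp mH (adapted_pair (ax k.+1 (leqnn _)) (axi k.+1 (leqnn _))).
have a2 := adapted_comp mH (adapted_pair (ax k (leqnSn _)) (axi k.+1 (leqnn _))).
move/adapted_measurable in IH; move/adapted_measurable in a1; move/adapted_measurable in a2.
apply/adapted_measurable => /=.
apply: measurable_mxB; last exact: measurable_mxZ.
by apply: measurable_mxD => //; exact: measurable_mxZ.
Qed.

Variables (x : nat -> Omega -> 'cV[R]_n) (zeta : nat -> Omega -> Z) (xi : nat -> Omega -> Xi).
Let F := history x zeta xi.

Lemma adapted_history_x j k : (j <= k)%N -> adapted (F k) (x j).
Proof.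
move=> jk A mA; apply: sub_sigma_algebra; left; exists j => //.
by exists A => //; rewrite setTI.
Qed.

Lemma adapted_history_zeta j k : (j < k)%N -> adapted (F k) (zeta j).
Proof.
move=> jk A mA; apply: sub_sigma_algebra; right; exists j => //; left.
by exists A => //; rewrite setTI.
Qed.

Lemma adapted_history_xi j k : (j < k)%N -> adapted (F k) (xi j).
Proof.
move=> jk A mA; apply: sub_sigma_algebra; right; exists j => //; right.
by exists A => //; rewrite setTI.
Qed.

Lemma history_full k : F k `<=` full_history x zeta xi.
Proof. by move=> A FA; apply: sub_sigma_algebra; exists k. Qed.

Hypothesis mx : forall k, measurable_fun setT (x k).
Hypothesis mzeta : forall k, measurable_fun setT (zeta k).
Hypothesis mxi : forall k, measurable_fun setT (xi k).

Lemma history_measurable k : F k `<=` measurable.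
Proof.
apply: smallest_sub; first exact: sigma_algebra_measurable.
move=> A [[j _ [B mB <-]]|[j _ [[B mB <-]|[B mB <-]]]].
- exact: mx.
- exact: mzeta.
- exact: mxi.
Qed.

Lemma full_history_measurable : full_history x zeta xi `<=` measurable.
Proof.
apply: smallest_sub; first exact: sigma_algebra_measurable.
by move=> A [k _]; exact: history_measurable.
Qed.

End Adapted.

Section UniformIndex.
Context {R : realType} {dO : measure_display} {Omega : measurableType dO}.
Variables (P : probability Omega R) (S : set (set Omega)) (K : nat).
Hypothesis mS : <<s S>> `<=` measurable.
Hypothesis K0 : (0 < K)%N.
Variable iota : {RV P >-> nat}.
Hypothesis iota_unif : uniform_index P K iota.
Hypothesis iota_indep : independent_of P <<s S>> iota.
Variable phi : nat -> Omega -> R.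
Hypothesis phi0 : forall k w, 0 <= phi k w.
Hypothesis aphi : forall k, adapted <<s S>> (phi k).

Let mphi k : measurable_fun setT (phi k).
Proof. by move=> _ A mA; rewrite setTI; by apply: mS; exact: aphi. Qed.

Let miota (B : set nat) : measurable (iota @^-1` B).
Proof. by rewrite -[X in measurable X]setTI; exact: measurable_funP. Qed.

Lemma integral_iota_indic k : (1 <= k <= K)%N ->
  (\int[P]_w (phi k w * \1_[set k] (iota w))%:E = K%:R^-1%:E * \int[P]_w (phi k w)%:E)%E.
Proof.
move=> kK.
(* The absolute value makes [psi] nonnegative on the whole product; it disappears along
   [phi k >= 0]. *)
pose psi (p : R * nat) := (`|p.1| * \1_[set k] p.2)%:E.
have mpsi : measurable_fun setT psi.
  apply/measurable_EFinP; apply: measurable_funM.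
    by apply: measurableT_comp => //; exact: measurable_fst.
  by apply: (measurableT_comp _ measurable_snd); exact: measurable_indic.
have psi0 p : (0 <= psi p)%E by rewrite lee_fin mulr_ge0.
have := integral_fresh mS (aphi k) iota_indep (fun B _ => erefl) mpsi psi0.
rewrite /psi/= => E.
transitivity (\int[P]_w (`|phi k w| * \1_[set k] (iota w))%:E)%E.
  by apply: eq_integral => w _; rewrite ger0_norm.
rewrite E -ge0_integralZl_EFin//; last 2 first.
- by move=> w _; rewrite lee_fin.
- exact/measurable_EFinP.
apply: eq_integral => w _; rewrite ger0_norm//.
under eq_integral do rewrite EFinM.
rewrite ge0_integralZl_EFin//.
rewrite integral_indic// setIT muleC; congr (_ * _)%E.
exact: iota_unif.
Qed.

(** [uniform_index] prescribes only the masses of [1, ..., K]. They add up to 1, which leaves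
    nothing for the other values. *)
Lemma iota_range_null : P (iota @^-1` [set k | ~~ (1 <= k <= K)%N]) = 0%E.
Proof.
set A := [set k | _].
have -> : iota @^-1` A = ~` \big[setU/set0]_(i < K) (iota @^-1` [set i.+1]).
  rewrite -(bigcup_mkord K (fun i => iota @^-1` [set i.+1])).
  apply/seteqP; split => w /=; rewrite /A/=.
    by move=> h [i /= iK ik]; move: h; rewrite ik/= iK.
  move=> h; apply/negP => /andP[i1 iK]; apply: h; exists (iota w).-1 => /=.
    by rewrite prednK.
  by rewrite prednK.
rewrite probability_setC; last by apply: bigsetU_measurable => i _; exact: miota.
have tF : trivIset [set: nat] (fun i => iota @^-1` [set i.+1]).
  apply/trivIsetP => i j _ _ ij; apply/seteqP; split => // w /= [-> [/eqP]].
  by rewrite (negbTE ij).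
have -> := measure_bigsetU P (fun i => miota [set i.+1]) tF K.
rewrite (eq_bigr (fun=> K%:R^-1%:E)); last by move=> i _; apply: iota_unif; rewrite ltn_ord.
rewrite sumEFin sumr_const card_ord.
have -> : K%:R^-1 *+ K = 1 :> R by rewrite -(mulr_natr K%:R^-1) mulVf// pnatr_eq0 -lt0n.
by rewrite subee.
Qed.

(* [h] is only bounded on the event [1 <= iota <= K] of probability 1, and it
   need not be measurable: compare with a bound that is [+oo] elsewhere. *)
Lemma integral_uniform_index_le (h : Omega -> R) :
  (forall w, 0 <= h w) ->
  (forall k w, (1 <= k <= K)%N -> iota w = k -> h w <= phi k w) ->
  (\int[P]_w (h w)%:E <= K%:R^-1%:E * \sum_(1 <= k < K.+1) \int[P]_w (phi k w)%:E)%E.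
Proof.
move=> h0 hle.
pose A := iota @^-1` [set k | ~~ (1 <= k <= K)%N].
pose D w := (\sum_(1 <= k < K.+1) (phi k w * \1_[set k] (iota w))%:E)%E.
have mterm k : measurable_fun setT (fun w => (phi k w * \1_[set k] (iota w))%:E).
  apply/measurable_EFinP; apply: measurable_funM => //.
  by apply: measurableT_comp => //; exact: measurable_indic.
have term0 k w : (0 <= (phi k w * \1_[set k] (iota w))%:E)%E by rewrite lee_fin mulr_ge0.
apply: (@le_trans _ _ (\int[P]_w (D w + (cst +oo \_ A) w))%E).
  apply: ge0_le_integral_nonmeasurable => w; first by rewrite lee_fin.
  have [wA|wA] := boolP (w \in A).
    rewrite patchE wA addey ?leey//.
    by rewrite gt_eqF// (lt_le_trans (ltNyr 0))// sume_ge0.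
  rewrite patchE (negbTE wA) adde0.
  have iw : (1 <= iota w <= K)%N by move: wA; rewrite notin_setE/= => /negP; rewrite negbK.
  rewrite /D (big_rem (iota w)) /=; last by rewrite mem_index_iota ltnS.
  rewrite indicE mem_set//= mulr1; apply: (@le_trans _ _ (phi (iota w) w)%:E).
    by rewrite lee_fin; exact: hle.
  by rewrite leeDl// sume_ge0.
rewrite ge0_integralD//; last 4 first.
- by move=> w _; exact: sume_ge0.
- by apply: emeasurable_sum.
- by move=> w _; rewrite patchE; case: ifP => _ //=; rewrite leey.
- apply: (measurable_restrictT (cst +oo%E) (miota _)).1; exact: measurable_cst.
have -> : (\int[P]_w (cst +oo \_ A) w = 0)%E.
  rewrite -integral_mkcond integral_cst; last exact: miota.
  by rewrite [X in (_ * X)%E](_ : _ = 0%E) ?mule0//; exact: iota_range_null.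
rewrite adde0 /D ge0_integral_sum//.
rewrite ge0_sume_distrr; last by move=> k _; apply: integral_ge0 => w _; rewrite lee_fin.
rewrite big_nat [leRHS]big_nat; apply: le_of_eq.
by apply: eq_bigr => k kK; rewrite integral_iota_indic.
Qed.

End UniformIndex.

(** * Expected decrease along the iterates *)

Section SCRN.
Context {R : realType} {n : nat} {dZ dXi dO : measure_display}.
Context {Z : measurableType dZ} {Xi : measurableType dXi} {Omega : measurableType dO}.
Variables (PZ : probability Z R) (PXi : probability Xi R) (P : probability Omega R).
Variables (f : 'cV[R]_n -> R) (G : R -> 'cV[R]_n -> Z -> 'cV[R]_n).
Variables (H : 'cV[R]_n -> Xi -> 'M[R]_n) (f_low L L_F sigma L_H : R).
Hypothesis f_C2 : twice_cont_diff f.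
Hypothesis hA : assumptionA PZ PXi f G H f_low L L_F sigma.
Hypothesis hB : assumptionB PXi H L_H.
Variables (x0 : 'cV[R]_n) (eta delta theta : R).
Hypothesis eta0 : 0 < eta.
Hypothesis L_eta : 2 * L * eta <= 1.
Hypothesis delta01 : 0 < delta < 1.
Hypothesis theta01 : 0 < theta < 1.
Variables (zeta : nat -> {RV P >-> Z}) (xi : nat -> {RV P >-> Xi}).
Variable x : nat -> {RV P >-> 'cV[R]_n}.
Hypothesis hx : scrn_rm PZ PXi G H x0 (fun=> eta) (fun=> delta) (fun=> theta) zeta xi x.

Let F := history x zeta xi.
Definition momentum_iter k w := momentum_hess H (fun=> theta) x xi k w.
Definition step_norm k w := euclid_norm (x k.+1 w - x k w).
Definition grad_error k w := euclid_norm (G delta (x k w) (zeta k w) - grad f (x k w)).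
Definition hess_error k w := frob_norm (momentum_iter k w - hess f (x k w)).

Let mF k : F k `<=` measurable.
Proof. by apply: history_measurable => j; exact: measurable_funP. Qed.

Let continuous_grad : continuous (grad f).
Proof. by have [_ dg _] := f_C2; move=> y; exact: differentiable_continuous. Qed.

Let continuous_fun : continuous f.
Proof. by have [df _ _] := f_C2; move=> y; exact: differentiable_continuous. Qed.

Let continuous_hess : continuous (hess f).
Proof. by have [_ _ ch] := f_C2. Qed.

Lemma measurable_Hx y : measurable_fun setT (H y).
Proof.
apply: (measurableT_comp (A_H_measurable hA) (_ : measurable_fun setT (pair y))).
exact: pair1_measurable.
Qed.

Let indep_zeta k : independent_of P (F k) (zeta k).
Proof.
move=> A B FA mB; have := scrn_fresh hx FA (measurableX mB measurableT).
by have -> : (fun w => (zeta k w, xi k w)) @^-1` (B `*` setT) = zeta k @^-1` B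
  by apply/seteqP; split => w /=; [case|].
Qed.

Let indep_xi k : independent_of P (F k) (xi k).
Proof.
move=> A B FA mB; have := scrn_fresh hx FA (measurableX measurableT mB).
by have -> : (fun w => (zeta k w, xi k w)) @^-1` (setT `*` B) = xi k @^-1` B
  by apply/seteqP; split => w /=; [case|].
Qed.

Lemma integral_grad_error k :
  (\int[P]_w (grad_error k w `^ (3 / 2))%:E <= (delta `^ (3 / 2))%:E)%E.
Proof.
pose phi (p : 'cV[R]_n * Z) := euclid_norm (G delta p.1 p.2 - grad f p.1) `^ (3 / 2).
have mphi : measurable_fun setT phi.
  apply: (measurableT_comp (measurable_powR (3 / 2))).
  apply: measurable_euclid_norm; apply: measurable_mxB.
    exact: (A_G_measurable hA).
  exact: (measurableT_comp (continuous_measurable_mx_mx continuous_grad)).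
rewrite -(integral_probability_cst P (delta `^ (3 / 2))%:E).
apply: (@integral_fresh_le _ _ _ _ _ _ _ P PZ (F k) (x k) (zeta k) phi) => //.
- exact: mF.
- exact: adapted_history_x.
- exact: (scrn_law_zeta hx).
- by move=> p; exact: powR_ge0.
- by move=> w; have := A_G_error hA delta01 (x k w); rewrite unlock.
Qed.

Lemma integral_hess_error0 :
  (\int[P]_w (hess_error 0 w ^+ 3)%:E <= (sigma ^+ 3)%:E)%E.
Proof.
pose phi (p : 'cV[R]_n * Xi) := frob_norm (H p.1 p.2 - hess f p.1) ^+ 3.
have mphi : measurable_fun setT phi.
  apply: measurable_funX; apply: measurable_frob_norm; apply: measurable_mxB.
    exact: (A_H_measurable hA).
  exact: (measurableT_comp (continuous_measurable_mx_mx continuous_hess)).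
rewrite -(integral_probability_cst P (sigma ^+ 3)%:E).
apply: (@integral_fresh_le _ _ _ _ _ _ _ P PXi (F 0) (x 0) (xi 0) phi) => //.
- exact: mF.
- exact: adapted_history_x.
- exact: (scrn_law_xi hx).
- by move=> p; rewrite exprn_ge0 ?frob_norm_ge0.
- by move=> w; have := A_H_error hA (x 0 w); rewrite unlock.
Qed.

Lemma measurable_momentum k : measurable_fun setT (momentum_iter k).
Proof.
(* The matrix [M_k] uses the sample [xi k], which enters the history only at time [k + 1]. *)
have am : adapted (F k.+1) (momentum_iter k).
  apply: adapted_momentum; first exact: (A_H_measurable hA).
    by move=> j jk; apply: adapted_history_x; exact: leqW.
  by move=> j jk; exact: adapted_history_xi.
by move=> _ A mA; rewrite setTI; exact: (mF (am A mA)).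
Qed.

Lemma measurable_hess_error k : measurable_fun setT (hess_error k).
Proof.
apply: measurable_frob_norm; apply: measurable_mxB; first exact: measurable_momentum.
exact: (measurableT_comp (continuous_measurable_mx_mx continuous_hess)).
Qed.

Lemma measurable_step_norm k : measurable_fun setT (step_norm k).
Proof. by apply: measurable_euclid_norm; exact: measurable_mxB. Qed.

Lemma measurable_grad_error k : measurable_fun setT (grad_error k).
Proof.
apply: measurable_euclid_norm; apply: measurable_mxB.
  have m := measurable_fun_pair (measurable_funP (x k)) (measurable_funP (zeta k)).
  exact: (measurableT_comp (A_G_measurable hA delta01) m).
exact: (measurableT_comp (continuous_measurable_mx_mx continuous_grad)).
Qed.

Lemma integral_hess_errorS k :
  (\int[P]_w (hess_error k.+1 w ^+ 3)%:E <=
   (1 - theta)%:E * \int[P]_w (hess_error k w ^+ 3)%:E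
   + (40 / Num.sqrt theta * (L_F ^+ 3 + L_H ^+ 3))%:E * \int[P]_w (step_norm k w ^+ 3)%:E
   + (10 * theta ^+ 3 / Num.sqrt theta * sigma ^+ 3)%:E)%E.
Proof.
case/andP: (theta01) => t0 t1.
have q0 : 0 < Num.sqrt theta by rewrite sqrtr_gt0.
have LF0 := A_L_F_gt0 hA; have LH0 := B_L_H_gt0 hB; have s0 := A_sigma_gt0 hA.
pose c := 10 * theta ^+ 3 / Num.sqrt theta * sigma ^+ 3.
pose b := 40 / Num.sqrt theta * (L_F ^+ 3 + L_H ^+ 3).
have c0 : 0 <= c.
  by rewrite /c mulr_ge0 ?exprn_ge0 ?(ltW s0)// divr_ge0 ?(ltW q0)// mulr_ge0// exprn_ge0// ltW.
have b0 : 0 <= b.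
  by rewrite /b mulr_ge0// ?divr_ge0 ?(ltW q0)// addr_ge0// exprn_ge0// ltW.
pose phi (p : 'M[R]_n * ('cV[R]_n * 'cV[R]_n) * Xi) :=
  frob_norm ((1 - theta) *: p.1.1 + H p.1.2.2 p.2 - (1 - theta) *: H p.1.2.1 p.2
             - hess f p.1.2.2) ^+ 3.
have mphi : measurable_fun setT phi.
  apply: measurable_funX; apply: measurable_frob_norm.
  have m1 : measurable_fun setT (fun p : 'M[R]_n * ('cV[R]_n * 'cV[R]_n) * Xi => p.1).
    exact: measurable_fst.
  have m2 : measurable_fun setT (fun p : 'M[R]_n * ('cV[R]_n * 'cV[R]_n) * Xi => p.2).
    exact: measurable_snd.
  have m12 := measurableT_comp measurable_snd m1.
  have m121 := measurableT_comp measurable_fst m12.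
  have m122 := measurableT_comp measurable_snd m12.
  apply: measurable_mxB; last first.
    exact: (measurableT_comp (continuous_measurable_mx_mx continuous_hess) m122).
  apply: measurable_mxB.
    apply: measurable_mxD.
      by apply: measurable_mxZ; exact: (measurableT_comp measurable_fst m1).
    exact: (measurableT_comp (A_H_measurable hA) (measurable_fun_pair m122 m2)).
  apply: measurable_mxZ.
  exact: (measurableT_comp (A_H_measurable hA) (measurable_fun_pair m121 m2)).
have mh3 : measurable_fun setT (fun w => hess_error k w ^+ 3).
  exact: (measurable_funX _ (measurable_hess_error k)).
have ms3 : measurable_fun setT (fun w => step_norm k w ^+ 3).
  exact: (measurable_funX _ (measurable_step_norm k)).
pose g w := (1 - theta) * hess_error k w ^+ 3 + b * step_norm k w ^+ 3 + c.
have mg1 : measurable_fun setT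
    (fun w => (1 - theta) * hess_error k w ^+ 3 + b * step_norm k w ^+ 3).
  by apply: measurable_funD; [exact: (measurable_funM (measurable_cst _) mh3)
                             |exact: (measurable_funM (measurable_cst _) ms3)].
have h30 w : 0 <= hess_error k w ^+ 3 by rewrite exprn_ge0 ?frob_norm_ge0.
have s30 w : 0 <= step_norm k w ^+ 3 by rewrite exprn_ge0 ?euclid_norm_ge0.
have mg : measurable_fun setT g by exact: measurable_funD.
have -> : ((1 - theta)%:E * \int[P]_w (hess_error k w ^+ 3)%:E
   + b%:E * \int[P]_w (step_norm k w ^+ 3)%:E + c%:E = \int[P]_w (g w)%:E)%E.
  under [RHS]eq_integral do rewrite EFinD.
  rewrite ge0_integralD//; last 2 first.
  - by move=> w _; rewrite lee_fin addr_ge0// mulr_ge0//; lra.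
  - exact/measurable_EFinP.
  rewrite integral_probability_cst (ge0_integral_lin P mh3 ms3 h30 s30 _ b0)//; lra.
(* Everything to be frozen: these three belong to the history at [k + 1], while [xi k.+1] is
   independent of it. *)
pose W w := (momentum_iter k w, (x k w, x k.+1 w)).
have aW : adapted (F k.+1) W.
  apply: adapted_pair.
    apply: adapted_momentum; first exact: (A_H_measurable hA).
      by move=> j jk; apply: adapted_history_x; exact: leqW.
    by move=> j jk; exact: adapted_history_xi.
  by apply: adapted_pair; apply: adapted_history_x.
have phi0 p : 0 <= phi p by rewrite exprn_ge0 ?frob_norm_ge0.
have -> : (fun w => (hess_error k.+1 w ^+ 3)%:E) = (fun w => (phi (W w, xi k.+1 w))%:E).
  by apply/funext.
apply: (integral_fresh_le (@mF k.+1) aW (@indep_xi k.+1) (scrn_law_xi hx k.+1)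
  mphi phi0 mg).
move=> w; rewrite /phi/=.
  have Hub y i j : (\int[PXi]_xi (H y xi i j)%:E = (hess f y i j)%:E)%E.
    by have := A_H_unbiased hA y i j; rewrite unlock.
  have Herr y : (\int[PXi]_xi (frob_norm (H y xi - hess f y) ^+ 3)%:E <= (sigma ^+ 3)%:E)%E.
    by have := A_H_error hA y; rewrite unlock.
  have Hsm y z : (\int[PXi]_xi (frob_norm (H z xi - H y xi) ^+ 3)%:E
     <= (L_H ^+ 3 * euclid_norm (z - y) ^+ 3)%:E)%E.
    by have := B_mean_cubed_smooth hB y z; rewrite unlock.
  have := integral_momentum_step LF0 (A_hess_lip_frob hA) measurable_Hx Hub Herr Hsm
    (momentum_iter k w) (x k w) (x k.+1 w) theta01.
  move/le_trans; apply; rewrite lee_fin /g -/(step_norm k w) -/(hess_error k w).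
  by rewrite -/b -/c addrAC.
Qed.

Lemma next_iterateE k w : x k w + (x k.+1 w - x k w) = x k.+1 w.
Proof. by rewrite addrC subrK. Qed.

Lemma iterate_argmin k w y :
  cubic_model (G delta (x k w) (zeta k w)) (momentum_iter k w) eta (x k w)
    (x k w + (x k.+1 w - x k w))
  <= cubic_model (G delta (x k w) (zeta k w)) (momentum_iter k w) eta (x k w) y.
Proof. by rewrite next_iterateE; exact: (scrn_step hx). Qed.

Lemma iterate_descent k w :
  f (x k.+1 w) + 11^-1 * (step_norm k w ^+ 3 / eta)
  <= f (x k w) + 20 / 3 * Num.sqrt eta * grad_error k w `^ (3 / 2)
     + 25 / 6 * eta ^+ 2 * hess_error k w ^+ 3.
Proof.
have := newton_descent_young f_C2 (A_hess_lip hA) eta0 L_eta (@iterate_argmin k w).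
by rewrite next_iterateE.
Qed.

Definition grad_bound k w :=
  25 / 12 / Num.sqrt eta ^+ 3 * step_norm k w ^+ 3 + 5 / 3 * grad_error k w `^ (3 / 2)
  + 5 / 6 * Num.sqrt eta ^+ 3 * hess_error k w ^+ 3.

Definition hess_bound k w := 4 / eta ^+ 3 * step_norm k w ^+ 3 + 4 * hess_error k w ^+ 3.

Lemma iterate_grad k w : euclid_norm (grad f (x k.+1 w)) `^ (3 / 2) <= grad_bound k w.
Proof.
have := grad_next_powR (A_L_gt0 hA) f_C2 (A_hess_lip hA) eta0 L_eta (@iterate_argmin k w).
rewrite next_iterateE => /le_trans; apply.
rewrite /grad_bound /step_norm /grad_error /hess_error.
by apply: le_of_eq; ring.
Qed.

Lemma iterate_lambda_min k w : - hess_bound k w <= lambda_min (hess f (x k.+1 w)) ^+ 3.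
Proof.
have := lambda_min_next (A_hess_lip hA) eta0 L_eta (@iterate_argmin k w).
rewrite next_iterateE; apply: le_trans.
by rewrite /hess_bound /step_norm /hess_error; apply: le_of_eq; ring.
Qed.

Lemma step_cube_ge0 k w : 0 <= step_norm k w ^+ 3.
Proof. by rewrite exprn_ge0 ?euclid_norm_ge0. Qed.

Lemma hess_error_cube_ge0 k w : 0 <= hess_error k w ^+ 3.
Proof. by rewrite exprn_ge0 ?frob_norm_ge0. Qed.

Lemma measurable_step_cube k : measurable_fun setT (fun w => step_norm k w ^+ 3).
Proof. exact: (measurable_funX _ (measurable_step_norm k)). Qed.

Lemma measurable_hess_error_cube k : measurable_fun setT (fun w => hess_error k w ^+ 3).
Proof. exact: (measurable_funX _ (measurable_hess_error k)). Qed.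

Lemma measurable_grad_error_powR k :
  measurable_fun setT (fun w => grad_error k w `^ (3 / 2)).
Proof. exact: (measurableT_comp (measurable_powR (3 / 2)) (measurable_grad_error k)). Qed.

(** The shift by [f_low] makes the integrand nonnegative, so that its integral adds up freely in the
    extended reals. *)
Let gap k w := f (x k w) - f_low.

Let gap_ge0 k w : 0 <= gap k w.
Proof. by rewrite subr_ge0; exact: (A_lower_bound hA). Qed.

Let measurable_gap k : measurable_fun setT (gap k).
Proof.
apply: measurable_funB => //.
exact: (measurableT_comp (continuous_measurable_mx continuous_fun)).
Qed.

Let sqrt_eta_ge0 : 0 <= Num.sqrt eta. Proof. exact: sqrtr_ge0. Qed.

Lemma ge0_integral_lin3 (a b c : R) (g h k : Omega -> R) :
  measurable_fun setT g -> measurable_fun setT h -> measurable_fun setT k ->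
  (forall t, 0 <= g t) -> (forall t, 0 <= h t) -> (forall t, 0 <= k t) ->
  0 <= a -> 0 <= b -> 0 <= c ->
  (\int[P]_t (a * g t + b * h t + c * k t)%:E
   = a%:E * \int[P]_t (g t)%:E + b%:E * \int[P]_t (h t)%:E
     + c%:E * \int[P]_t (k t)%:E)%E.
Proof.
move=> mg mh mk g0 h0 k0 a0 b0 c0.
have m1 : measurable_fun setT (fun t => a * g t + b * h t).
  by apply: measurable_funD; apply: measurable_funM.
have p1 t : 0 <= a * g t + b * h t by rewrite addr_ge0// mulr_ge0.
have := ge0_integral_lin P m1 mk p1 k0 ler01 c0.
under eq_integral do rewrite mul1r.
by rewrite mul1e => ->; rewrite ge0_integral_lin.
Qed.

Lemma integral_descent k :
  (\int[P]_w (gap k.+1 w)%:E + (11^-1 / eta)%:E * \int[P]_w (step_norm k w ^+ 3)%:E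
   <= \int[P]_w (gap k w)%:E + (20 / 3 * Num.sqrt eta * delta `^ (3 / 2))%:E
      + (25 / 6 * eta ^+ 2)%:E * \int[P]_w (hess_error k w ^+ 3)%:E)%E.
Proof.
have c1 : 0 <= 11^-1 / eta by rewrite divr_ge0// ltW.
have c2 : 0 <= 20 / 3 * Num.sqrt eta by rewrite mulr_ge0.
have c3 : 0 <= 25 / 6 * eta ^+ 2 by rewrite mulr_ge0 ?sqr_ge0.
have E1 := ge0_integral_lin P (measurable_gap k.+1) (measurable_step_cube k)
  (@gap_ge0 k.+1) (@step_cube_ge0 k) ler01 c1.
have E2 := ge0_integral_lin3 (measurable_gap k) (measurable_grad_error_powR k)
  (measurable_hess_error_cube k) (@gap_ge0 k) (fun w => powR_ge0 _ _)
  (@hess_error_cube_ge0 k) ler01 c2 c3.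
rewrite mul1e in E1; rewrite mul1e in E2.
rewrite -E1; apply: (@le_trans _ _ (\int[P]_w (1 * gap k w
   + 20 / 3 * Num.sqrt eta * grad_error k w `^ (3 / 2)
   + 25 / 6 * eta ^+ 2 * hess_error k w ^+ 3)%:E)%E).
  apply: ge0_le_integral_nonmeasurable => w; rewrite lee_fin.
    by rewrite mul1r addr_ge0// mulr_ge0// step_cube_ge0.
  have := iterate_descent k w; rewrite /gap !mul1r.
  have -> : 11^-1 / eta * step_norm k w ^+ 3 = 11^-1 * (step_norm k w ^+ 3 / eta).
    by ring.
  by move=> h; lra.
rewrite E2; apply: leeD => //; apply: leeD => //.
rewrite (EFinM (20 / 3 * Num.sqrt eta)); apply: lee_wpmul2l; first by rewrite lee_fin.
exact: integral_grad_error.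
Qed.

Let b_const := 40 / Num.sqrt theta * (L_F ^+ 3 + L_H ^+ 3).
Let c_const := 10 * theta ^+ 3 / Num.sqrt theta * sigma ^+ 3.

(** By induction: if the gap and the Hessian error at [k] have finite integrals, the descent
    inequality bounds the next gap and the step, and then the momentum recursion bounds the next
    Hessian error. *)
Lemma integrals_fin_num k :
  [/\ (\int[P]_w (gap k w)%:E)%E \is a fin_num,
      (\int[P]_w (hess_error k w ^+ 3)%:E)%E \is a fin_num
    & (\int[P]_w (step_norm k w ^+ 3)%:E)%E \is a fin_num].
Proof.
have nn (g : Omega -> R) : (forall w, 0 <= g w) -> (0 <= \int[P]_w (g w)%:E)%E.
  by move=> g0; apply: integral_ge0 => w _; rewrite lee_fin.
have step j : (\int[P]_w (gap j w)%:E)%E \is a fin_num ->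
  (\int[P]_w (hess_error j w ^+ 3)%:E)%E \is a fin_num ->
  (\int[P]_w (gap j.+1 w)%:E)%E \is a fin_num
  /\ (\int[P]_w (step_norm j w ^+ 3)%:E)%E \is a fin_num.
  move=> /fineK ga /fineK va; have := integral_descent j.
  rewrite -ga -va -!EFinM -!EFinD => h.
  have n1 := nn _ (@gap_ge0 j.+1); have n2 := nn _ (@step_cube_ge0 j).
  have c1 : 0 < 11^-1 / eta by rewrite divr_gt0.
  split; rewrite ge0_fin_numE//.
    apply: le_lt_trans (ltry _); apply: le_trans h.
    by rewrite leeDl// mule_ge0// lee_fin ltW.
  have : ((11^-1 / eta)%:E * \int[P]_w (step_norm j w ^+ 3)%:E < +oo)%E.
    by apply: le_lt_trans (ltry _); apply: le_trans h; rewrite leeDr.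
  move=> h'; rewrite ltey; apply/eqP => E; move: h'.
  by rewrite E gt0_muley ?lte_fin// ltxx.
suff [h1 h2] : (\int[P]_w (gap k w)%:E)%E \is a fin_num
    /\ (\int[P]_w (hess_error k w ^+ 3)%:E)%E \is a fin_num.
  by have [_ h3] := step _ h1 h2; split; [exact: h1|exact: h2|exact: h3].
elim: k => [|k [h1 h2]].
  split.
    rewrite (eq_integral (fun=> (f x0 - f_low)%:E)); last first.
      by move=> w _; rewrite /gap (scrn_start hx).
    by rewrite integral_probability_cst.
  rewrite ge0_fin_numE; last exact/nn/hess_error_cube_ge0.
  exact: le_lt_trans integral_hess_error0 (ltry _).
have [h3 h4] := step _ h1 h2; split; first exact: h3.
rewrite ge0_fin_numE; last exact/nn/hess_error_cube_ge0.
have gen (X V S : \bar R) (a b c : R) : (X <= a%:E * V + b%:E * S + c%:E)%E ->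
    V \is a fin_num -> S \is a fin_num -> (X < +oo)%E.
  move=> h /fineK e1 /fineK e2; move: h; rewrite -e1 -e2 -!EFinM -!EFinD.
  by move=> /le_lt_trans; apply; exact: ltry.
exact: (gen _ _ _ _ _ _ (integral_hess_errorS k) h2 h4).
Qed.

Lemma moments_recursion : exists a v r : nat -> R,
  [/\ a 0%N = f x0 - f_low, v 0%N <= sigma ^+ 3,
      (forall k, [/\ 0 <= a k, 0 <= v k & 0 <= r k]),
      (forall k, (\int[P]_w (hess_error k w ^+ 3)%:E = (v k)%:E)%E
                 /\ (\int[P]_w (step_norm k w ^+ 3)%:E = (r k)%:E)%E)
    & forall k,
      a k.+1 + 11^-1 / eta * r k
        <= a k + 20 / 3 * Num.sqrt eta * delta `^ (3 / 2) + 25 / 6 * eta ^+ 2 * v k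
      /\ v k.+1 <= (1 - theta) * v k + b_const * r k + c_const].
Proof.
exists (fun k => fine (\int[P]_w (gap k w)%:E)%E),
  (fun k => fine (\int[P]_w (hess_error k w ^+ 3)%:E)%E),
  (fun k => fine (\int[P]_w (step_norm k w ^+ 3)%:E)%E).
split.
- rewrite (eq_integral (fun=> (f x0 - f_low)%:E)); last first.
    by move=> w _; rewrite /gap (scrn_start hx).
  by rewrite integral_probability_cst.
- have [_ h _] := integrals_fin_num 0.
  by rewrite -lee_fin fineK//; exact: integral_hess_error0.
- move=> k; split; apply: fine_ge0; apply: integral_ge0 => w _; rewrite lee_fin.
  + exact: gap_ge0.
  + exact: hess_error_cube_ge0.
  + exact: step_cube_ge0.
- by move=> k; have [_ h2 h3] := integrals_fin_num k; rewrite !fineK.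
- move=> k; have [h1 h2 h3] := integrals_fin_num k.
  have [g1 g2 _] := integrals_fin_num k.+1.
  have gen1 (A A' S V : \bar R) (b c d : R) : A \is a fin_num -> A' \is a fin_num ->
      S \is a fin_num -> V \is a fin_num -> (A' + b%:E * S <= A + c%:E + d%:E * V)%E ->
      fine A' + b * fine S <= fine A + c + d * fine V.
    move=> /fineK e1 /fineK e2 /fineK e3 /fineK e4.
    by rewrite -e1 -e2 -e3 -e4 -!EFinM -!EFinD lee_fin.
  have gen2 (V V' S : \bar R) (b c d : R) : V \is a fin_num -> V' \is a fin_num ->
      S \is a fin_num -> (V' <= b%:E * V + c%:E * S + d%:E)%E ->
      fine V' <= b * fine V + c * fine S + d.
    move=> /fineK e1 /fineK e2 /fineK e3.
    by rewrite -e1 -e2 -e3 -!EFinM -!EFinD lee_fin.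
  split; first exact: (gen1 _ _ _ _ _ _ _ h1 g1 h3 h2 (integral_descent k)).
  exact: (gen2 _ _ _ _ _ _ h2 g2 h3 (integral_hess_errorS k)).
Qed.

(** * The iterate selected by the random index *)

Let FF := full_history x zeta xi.

Let adapted_x j : adapted FF (x j).
Proof.
move=> A mA; apply: (@history_full _ _ _ _ _ _ _ _ _ _ _ j).
exact: adapted_history_x.
Qed.

Let adapted_zeta j : adapted FF (zeta j).
Proof.
move=> A mA; apply: (@history_full _ _ _ _ _ _ _ _ _ _ _ j.+1).
exact: adapted_history_zeta.
Qed.

Let adapted_xi j : adapted FF (xi j).
Proof.
move=> A mA; apply: (@history_full _ _ _ _ _ _ _ _ _ _ _ j.+1).
exact: adapted_history_xi.
Qed.

Let adapted_momentum_iter j : adapted FF (momentum_iter j).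
Proof.
apply: adapted_momentum; first exact: (A_H_measurable hA).
  by move=> i _; exact: adapted_x.
by move=> i _; exact: adapted_xi.
Qed.

Let adapted_step_cube j : adapted FF (fun w => step_norm j w ^+ 3).
Proof.
apply/adapted_measurable; apply: measurable_funX; apply: measurable_euclid_norm.
by apply: measurable_mxB; apply/adapted_measurable; exact: adapted_x.
Qed.

Let adapted_hess_error_cube j : adapted FF (fun w => hess_error j w ^+ 3).
Proof.
apply/adapted_measurable; apply: measurable_funX; apply: measurable_frob_norm.
apply: measurable_mxB; apply/adapted_measurable; first exact: adapted_momentum_iter.
exact: (adapted_comp (continuous_measurable_mx_mx continuous_hess) (adapted_x j)).
Qed.

Let adapted_grad_error_powR j : adapted FF (fun w => grad_error j w `^ (3 / 2)).
Proof.
apply: (adapted_comp (measurable_powR (3 / 2))).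
apply/adapted_measurable; apply: measurable_euclid_norm.
apply: measurable_mxB; apply/adapted_measurable.
  exact: (adapted_comp (A_G_measurable hA delta01) (adapted_pair (adapted_x j) (adapted_zeta j))).
exact: (adapted_comp (continuous_measurable_mx_mx continuous_grad) (adapted_x j)).
Qed.

Let s3 := Num.sqrt eta ^+ 3.
Let s30 : 0 < s3. Proof. by rewrite exprn_gt0// sqrtr_gt0. Qed.
Let cg1 : 0 <= 25 / 12 / s3. Proof. by rewrite divr_ge0// ltW. Qed.
Let cg3 : 0 <= 5 / 6 * s3. Proof. by rewrite mulr_ge0// ltW. Qed.
Let ch1 : 0 <= 4 / eta ^+ 3. Proof. by rewrite divr_ge0// exprn_ge0// ltW. Qed.

Let adapted_grad_bound j : adapted FF (grad_bound j).
Proof.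
apply/adapted_measurable; apply: measurable_funD.
  apply: measurable_funD.
    apply: (measurable_funM (measurable_cst _)).
    by apply/adapted_measurable; exact: adapted_step_cube.
  apply: (measurable_funM (measurable_cst _)).
  by apply/adapted_measurable; exact: adapted_grad_error_powR.
apply: (measurable_funM (measurable_cst _)).
by apply/adapted_measurable; exact: adapted_hess_error_cube.
Qed.

Let adapted_hess_bound j : adapted FF (hess_bound j).
Proof.
apply/adapted_measurable; apply: measurable_funD.
  apply: (measurable_funM (measurable_cst _)).
  by apply/adapted_measurable; exact: adapted_step_cube.
apply: (measurable_funM (measurable_cst _)).
by apply/adapted_measurable; exact: adapted_hess_error_cube.
Qed.

Let grad_bound_ge0 j w : 0 <= grad_bound j w.
Proof.
apply: addr_ge0; last exact: (mulr_ge0 cg3 (hess_error_cube_ge0 j w)).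
by apply: addr_ge0; [exact: (mulr_ge0 cg1 (step_cube_ge0 j w))|rewrite mulr_ge0// powR_ge0].
Qed.

Let hess_bound_ge0 j w : 0 <= hess_bound j w.
Proof.
apply: addr_ge0; first exact: (mulr_ge0 ch1 (step_cube_ge0 j w)).
by rewrite mulr_ge0// hess_error_cube_ge0.
Qed.

Variables (K : nat) (iota : {RV P >-> nat}).
Hypothesis K0 : (0 < K)%N.
Hypothesis iota_unif : uniform_index P K iota.
Hypothesis iota_indep : independent_of P FF iota.

Let mFF : FF `<=` measurable.
Proof. by apply: full_history_measurable => j; exact: measurable_funP. Qed.

Lemma output_le (h : Omega -> R) (phi : nat -> Omega -> R) (c : nat -> R) :
  (forall j, adapted FF (phi j)) -> (forall j w, 0 <= phi j w) ->
  (forall w, 0 <= h w) ->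
  (forall j w, iota w = j.+1 -> h w <= phi j w) ->
  (forall j, \int[P]_w (phi j w)%:E <= (c j)%:E)%E ->
  (\int[P]_w (h w)%:E <= (K%:R^-1 * \sum_(j < K) c j)%:E)%E.
Proof.
move=> aphi phi0 h0 hphi cphi.
(* Iterate [k] is produced by step [k - 1], hence the shift of the index. *)
have := @integral_uniform_index_le _ _ _ P _ K mFF K0 iota iota_unif iota_indep
  (fun k => phi k.-1) (fun k => phi0 k.-1) (fun k => aphi k.-1) h h0.
move=> /(_ _)/le_trans; apply.
  by case=> [//|k] w _; exact: hphi.
rewrite EFinM; apply: lee_wpmul2l; first by rewrite lee_fin invr_ge0.
rewrite big_add1 big_mkord -sumEFin.
by apply: lee_sum => j _; exact: cphi.
Qed.

Lemma output_moments : exists a v r : nat -> R,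
  [/\ a 0%N = f x0 - f_low, v 0%N <= sigma ^+ 3,
      (forall k, [/\ 0 <= a k, 0 <= v k & 0 <= r k]),
      (forall k,
      a k.+1 + 11^-1 / eta * r k
        <= a k + 20 / 3 * Num.sqrt eta * delta `^ (3 / 2) + 25 / 6 * eta ^+ 2 * v k
      /\ v k.+1 <= (1 - theta) * v k + b_const * r k + c_const)
    & ('E_P[(fun w => euclid_norm (grad f (x (iota w) w)) `^ (3 / 2))%R]
        <= (K%:R^-1 * \sum_(j < K) (25 / 12 / s3 * r j + 5 / 3 * delta `^ (3 / 2)
               + 5 / 6 * s3 * v j))%:E
      /\ (- (K%:R^-1 * \sum_(j < K) (4 / eta ^+ 3 * r j + 4 * v j)))%:E
         <= 'E_P[(fun w => lambda_min (hess f (x (iota w) w)) ^+ 3)%R])%E].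
Proof.
have [a [v [r [a0 v0 avr ivr rec]]]] := moments_recursion.
exists a, v, r; split => //; rewrite !expectation.unlock; split.
  apply: (output_le (c := fun j => 25 / 12 / s3 * r j + 5 / 3 * delta `^ (3 / 2)
    + 5 / 6 * s3 * v j) adapted_grad_bound grad_bound_ge0) => [w|j w iw|j].
  - exact: powR_ge0.
  - by rewrite iw; exact: iterate_grad.
  rewrite (ge0_integral_lin3 (measurable_step_cube j) (measurable_grad_error_powR j)
    (measurable_hess_error_cube j) (@step_cube_ge0 j) (fun w => powR_ge0 _ _)
    (@hess_error_cube_ge0 j) cg1 _ cg3)//.
  have [-> ->] := ivr j; rewrite -!EFinM EFinD leeD2r// EFinD leeD2l//.
  rewrite (EFinM (5 / 3)); apply: lee_wpmul2l; first by rewrite lee_fin.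
  exact: integral_grad_error.
set lam := fun w : Omega => lambda_min (hess f (x (iota w) w)) ^+ 3.
(* The expectation of [lam] is the integral of its positive part, which is nonnegative, minus that
   of its negative part; bounding the latter is enough. *)
have neg : (\int[P]_w (Num.max 0 (- lam w))%:E
    <= (K%:R^-1 * \sum_(j < K) (4 / eta ^+ 3 * r j + 4 * v j))%:E)%E.
  apply: (output_le (c := fun j => 4 / eta ^+ 3 * r j + 4 * v j)
    adapted_hess_bound hess_bound_ge0) => [w|j w iw|j].
  - by rewrite le_max lexx.
  - rewrite ge_max hess_bound_ge0/= lerNl /lam iw; exact: iterate_lambda_min.
  rewrite (ge0_integral_lin P (measurable_step_cube j)
    (measurable_hess_error_cube j) (@step_cube_ge0 j) 
    (@hess_error_cube_ge0 j) ch1 _)//.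
  by have [-> ->] := ivr j; rewrite -!EFinM -EFinD.
rewrite integralE.
have -> : (\int[P]_w ((fun w => (lam w)%:E)^\- w) = \int[P]_w (Num.max 0 (- lam w))%:E)%E.
  by apply: eq_integral => w _; rewrite funenegE -EFinN -EFin_max maxC.
rewrite EFinN -[leLHS]add0e; apply: leeB => //.
by apply: integral_ge0 => w _; rewrite funepos_ge0.
Qed.

End SCRN.

(** * The convergence rate *)

Section Rates.
Context {R : realType}.

Lemma telescope_le (a p s : nat -> R) (b c d : R) (K : nat) :
  (forall k, a k.+1 + b * p k <= a k + c + d * s k) ->
  a K + b * \sum_(k < K) p k <= a 0%N + K%:R * c + d * \sum_(k < K) s k.
Proof.
move=> rec; elim: K => [|K IH]; first by rewrite !big_ord0 !mulr0 mul0r !addr0.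
rewrite !big_ord_recr/= -natr1 !mulrDr mulrDl mul1r; have := rec K; move: IH.
set X := b * _; set Y := d * \sum_(k < K) _; set Z := b * p K; set W := d * s K.
by lra.
Qed.

(* [l] stands for [(L_F^3 + L_H^3)^(1/3)]; [X] and [T] are the sums over [k] of
   [E |x_(k+1) - x_k|^3 / eta] and of [eta^2 E |M_k - hess f x_k|^3]. *)
Lemma potential_bounds (F0 sigma l v0 X T : R) :
  0 <= F0 -> 0 < l -> 0 < sigma -> v0 <= sigma ^+ 3 -> 0 <= X -> 0 <= T ->
  11^-1 * X <= F0 + 20 / 867 + 25 / 6 * T ->
  625 * l ^+ 2 * T <= v0 + 8 / 5 * l ^+ 2 * X + 10 * (25 / 17) ^+ 5 * l ^+ 5 * sigma ^+ 3 ->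
  let D := F0 + sigma ^+ 3 / l ^+ 2 + l ^+ 3 * sigma ^+ 3 + 1 in
  X <= 13 * D /\ T <= D.
Proof.
move=> F00 l0 s0 v0s X0 T0 h1 h2 D.
have l2 : 0 < l ^+ 2 by rewrite exprn_gt0.
have U0 : 0 <= sigma ^+ 3 / l ^+ 2 by rewrite divr_ge0// exprn_ge0// ltW.
have W0 : 0 <= l ^+ 3 * sigma ^+ 3 by rewrite mulr_ge0// exprn_ge0// ltW.
have h3 : 625 * T <= sigma ^+ 3 / l ^+ 2 + 8 / 5 * X
    + 10 * (25 / 17) ^+ 5 * (l ^+ 3 * sigma ^+ 3).
  rewrite -(ler_pM2l l2); apply: le_trans (_ : 625 * l ^+ 2 * T <= _).
    by apply: le_of_eq; ring.
  apply: le_trans h2 _; apply: le_trans (_ : sigma ^+ 3 + 8 / 5 * l ^+ 2 * X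
     + 10 * (25 / 17) ^+ 5 * l ^+ 5 * sigma ^+ 3 <= _).
    by rewrite !lerD2r.
  by apply: le_of_eq; field; exact: lt0r_neq0.
have h4 : (25 / 17) ^+ 5 <= 7 :> R by lra.
have h5 := ler_wpM2r W0 h4.
(* Substituting one inequality into the other is a loop of gain [11 * (25/6) * (8/5) / 625 < 1/8],
   so both can be solved. *)
move: h3 h5; rewrite /D; set U := sigma ^+ 3 / l ^+ 2 in U0 *; set W := l ^+ 3 * _ in W0 *.
by rewrite -(mulrA 10); set Y := _ ^+ 5 * W => h3 h5; split; lra.
Qed.

Lemma grad_rate (c X T D : R) : 0 < c -> c ^+ 2 = 17 -> 1 <= D ->
  0 <= X -> 0 <= T -> X <= 13 * D -> T <= D ->
  25 / 12 * c * X + 5 / (51 * c) + 5 / 6 * c * T <= 225 * D.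
Proof.
move=> c0 c2 D1 X0 T0 XD TD.
have c5 : c <= 5 by rewrite -(@ler_pXn2r _ 2) ?nnegrE ?(ltW c0)// c2; lra.
have c4 : 4 <= c by rewrite -(@ler_pXn2r _ 2) ?nnegrE ?(ltW c0)// c2; lra.
have h1 : c * X <= 5 * (13 * D) by apply: ler_pM => //; exact: ltW.
have h2 : c * T <= 5 * D by apply: ler_pM => //; exact: ltW.
have h3 : 5 / (51 * c) <= 1 by rewrite ler_pdivrMr ?mulr_gt0//; lra.
by rewrite -!(mulrA _ c); move: h1 h2 h3; set Y := c * X; set Z := c * T; set W := 5 / _; lra.
Qed.

End Rates.

Lemma powR_natdiv {R : realType} (a : R) (m k : nat) : 0 <= a ->
  a `^ (m%:R / k%:R) = (a `^ k%:R^-1) ^+ m.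
Proof. by move=> a0; rewrite mulrC powRrM powR_mulrn// powR_ge0. Qed.

(* 13/6 >= 625/289, and this is what makes [theta < 1]. *)
Lemma theta_margin {R : realType} : (13 / 6) ^+ 5 < 49 :> R.
Proof. by lra. Qed.

Lemma hess_rate {R : realType} (X T D : R) : 1 <= D -> X <= 13 * D -> T <= D ->
  1156 * (X + T) <= 21075 * D.
Proof. by move=> *; lra. Qed.

(* [q], [l] and [c] stand for [K^(1/10)], [(L_F^3 + L_H^3)^(1/3)] and [sqrt 17],
   which turns the powers of the step-size schedule into integer ones. *)
Section Schedule.
Context {R : realType}.
Variables (q l c : R).
Hypothesis q0 : 0 < q.
Hypothesis l0 : 0 < l.
Hypothesis c0 : 0 < c.
Hypothesis c2 : c ^+ 2 = 17.

Let qn0 : q != 0. Proof. exact: lt0r_neq0. Qed.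
Let cn0 : c != 0. Proof. exact: lt0r_neq0. Qed.

Let eta := 1 / (17 * q ^+ 2).
Let delta := 1 / (17 * q ^+ 6).
Let theta := 625 * l ^+ 2 / (289 * q ^+ 4).

Lemma eta_gt0 : 0 < eta.
Proof. by rewrite divr_gt0// mulr_gt0 ?ltr0n ?exprn_gt0. Qed.

Lemma delta_gt0 : 0 < delta.
Proof. by rewrite divr_gt0// mulr_gt0 ?ltr0n ?exprn_gt0. Qed.

Lemma delta_lt1 : 1 <= q -> delta < 1.
Proof.
move=> q1; have q6 : 1 <= q ^+ 6 by rewrite exprn_ege1.
by rewrite ltr_pdivrMr ?mulr_gt0 ?ltr0n ?exprn_gt0// mul1r; lra.
Qed.

Lemma sqrt_eta : Num.sqrt eta = 1 / (c * q).
Proof.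
have -> : eta = (1 / (c * q)) ^+ 2 by rewrite /eta -c2; field; rewrite qn0 cn0.
by rewrite sqrtr_sqr ger0_norm// divr_ge0// mulr_ge0 ?(ltW q0) ?(ltW c0).
Qed.

Lemma delta_powR : delta `^ (3 / 2) = 1 / (17 * c * q ^+ 9).
Proof.
rewrite sqrt_cubeE ?(ltW delta_gt0)//.
have -> : delta = (1 / (c * q ^+ 3)) ^+ 2 by rewrite /delta -c2; field; rewrite qn0 cn0.
rewrite sqrtr_sqr ger0_norm; last first.
  by rewrite divr_ge0// mulr_ge0 ?exprn_ge0 ?(ltW q0) ?(ltW c0).
by rewrite -c2; field; rewrite qn0 cn0.
Qed.

(** That is, [theta = (25 l eta)^2]. *)
Let thetaE : theta = (25 * l / (17 * q ^+ 2)) ^+ 2.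
Proof. by rewrite /theta; field. Qed.

Lemma sqrt_theta : Num.sqrt theta = 25 * l / (17 * q ^+ 2).
Proof.
rewrite thetaE sqrtr_sqr ger0_norm// divr_ge0// mulr_ge0 ?ler0n ?exprn_ge0//.
  exact: ltW.
exact: ltW.
Qed.

Lemma theta_gt0 : 0 < theta.
Proof. by rewrite thetaE exprn_gt0// divr_gt0// mulr_gt0 ?ltr0n ?exprn_gt0. Qed.

(** If [theta >= 1], then [q^4 <= (13/6) l^2]. Its fifth power and the square of the hypothesis both
    bear on [q^20] and contradict each other. *)
Lemma theta_lt1 : 7 * l ^+ 5 <= q ^+ 10 -> theta < 1.
Proof.
move=> hl; have q4 : 0 < q ^+ 4 by rewrite exprn_gt0.
have l2 : 0 <= l ^+ 2 by exact: sqr_ge0.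
rewrite /theta ltr_pdivrMr ?mulr_gt0 ?ltr0n// mul1r ltNge; apply/negP => h.
have h1 : q ^+ 4 <= 13 / 6 * l ^+ 2 by lra.
have h2 : (q ^+ 4) ^+ 5 <= (13 / 6 * l ^+ 2) ^+ 5.
  by rewrite ler_pXn2r// nnegrE; [exact: ltW|rewrite mulr_ge0].
have h3 : (7 * l ^+ 5) ^+ 2 <= (q ^+ 10) ^+ 2.
  rewrite ler_pXn2r// nnegrE; last exact/exprn_ge0/ltW.
  by apply: mulr_ge0 => //; exact/exprn_ge0/ltW.
have e1 : (q ^+ 4) ^+ 5 = (q ^+ 10) ^+ 2 by rewrite -!exprM.
have e2 : (13 / 6 * l ^+ 2) ^+ 5 = (13 / 6) ^+ 5 * l ^+ 10 by rewrite (exprMn _ (13 / 6)) -exprM.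
have e3 : (7 * l ^+ 5) ^+ 2 = 49 * l ^+ 10 by ring.
rewrite e1 e2 in h2; rewrite e3 in h3; have := le_trans h3 h2.
apply/negP; rewrite -ltNge ltr_pM2r ?exprn_gt0//; exact: theta_margin.
Qed.

Lemma L_eta_le1 (L : R) : 0 < L -> (2 * L / 17) ^+ 5 <= q ^+ 10 -> 2 * L * eta <= 1.
Proof.
move=> L0 h; have {}h : 2 * L / 17 <= q ^+ 2.
  rewrite -(@ler_pXn2r _ 5) ?nnegrE ?sqr_ge0//; first by rewrite -exprM.
  by rewrite divr_ge0// mulr_ge0// ltW.
have q2 : 0 < q ^+ 2 by rewrite exprn_gt0.
by rewrite /eta mulrA mulr1 ler_pdivrMr ?mulr_gt0// mul1r; lra.
Qed.

Variables (sigma F0 : R) (a v r : nat -> R).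
Hypothesis sigma0 : 0 < sigma.
Hypothesis F00 : 0 <= F0.
Hypothesis a0 : a 0%N = F0.
Hypothesis v0 : v 0%N <= sigma ^+ 3.
Hypothesis avr : forall k, [/\ 0 <= a k, 0 <= v k & 0 <= r k].
Hypothesis rec : forall k,
  a k.+1 + 11^-1 / eta * r k
    <= a k + 20 / 3 * Num.sqrt eta * delta `^ (3 / 2) + 25 / 6 * eta ^+ 2 * v k
  /\ v k.+1 <= (1 - theta) * v k + 40 / Num.sqrt theta * l ^+ 3 * r k
       + 10 * theta ^+ 3 / Num.sqrt theta * sigma ^+ 3.
Variable K : nat.
Hypothesis q10 : K%:R = q ^+ 10.
Let D := F0 + sigma ^+ 3 / l ^+ 2 + l ^+ 3 * sigma ^+ 3 + 1.
Let S := \sum_(j < K) r j.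
Let V := \sum_(j < K) v j.

Let ln0 : l != 0. Proof. exact: lt0r_neq0. Qed.
Let S0 : 0 <= S. Proof. by apply: sumr_ge0 => j _; have [] := avr j. Qed.
Let V0 : 0 <= V. Proof. by apply: sumr_ge0 => j _; have [] := avr j. Qed.
Let X := S / eta.
Let T := eta ^+ 2 * V.
Let X0 : 0 <= X. Proof. by rewrite divr_ge0// ltW// eta_gt0. Qed.
Let T0 : 0 <= T. Proof. by rewrite mulr_ge0// sqr_ge0. Qed.

(** The schedule makes [K sqrt(eta) delta^(3/2)] and [K theta^(5/2)], the accumulated constant terms
    of the two recursions, independent of [K]. *)
Lemma sums_bounds : X <= 13 * D /\ T <= D.
Proof.
apply: (@potential_bounds _ F0 sigma l (v 0%N)) => //.
  have h := telescope_le K (fun k => (rec k).1).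
  have [aK _ _] := avr K.
  have e1 : K%:R * (20 / 3 * Num.sqrt eta * delta `^ (3 / 2)) = 20 / 867.
    rewrite sqrt_eta delta_powR q10.
    have -> : q ^+ 10 * (20 / 3 * (1 / (c * q)) * (1 / (17 * c * q ^+ 9)))
       = 20 / 51 / c ^+ 2 by field; rewrite qn0 cn0.
    by rewrite c2; field.
  have e2 : 11^-1 * X = 11^-1 / eta * S by rewrite /X; ring.
  have e3 : 25 / 6 * T = 25 / 6 * eta ^+ 2 * V by rewrite /T; ring.
  by rewrite e1 a0 in h; rewrite e2 e3; apply: le_trans h; rewrite lerDr.
(* In this form [theta * v k] plays the role of the decrease in [telescope_le]. *)
have rec2 k : v k.+1 + theta * v k <= v k + 10 * theta ^+ 3 / Num.sqrt theta * sigma ^+ 3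
     + 40 / Num.sqrt theta * l ^+ 3 * r k.
  rewrite -lerBrDr; apply: le_trans (rec k).2 _.
  by apply: le_of_eq; ring.
have h := telescope_le K rec2; have [_ vK _] := avr K.
have e1 : theta * V = 625 * l ^+ 2 * T.
  by rewrite /T /theta /eta; field.
have e2 : 40 / Num.sqrt theta * l ^+ 3 * S = 8 / 5 * l ^+ 2 * X.
  by rewrite sqrt_theta /X /eta; field; rewrite qn0 ln0.
have e3 : K%:R * (10 * theta ^+ 3 / Num.sqrt theta * sigma ^+ 3)
    = 10 * (25 / 17) ^+ 5 * l ^+ 5 * sigma ^+ 3.
  by rewrite sqrt_theta thetaE q10; field; rewrite qn0 ln0.
rewrite -/S -/V e1 e2 e3 in h.
by rewrite addrAC; apply: le_trans h; rewrite lerDr.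
Qed.

Let D1 : 1 <= D.
Proof.
have u0 : 0 <= sigma ^+ 3 / l ^+ 2 by apply: divr_ge0; apply: exprn_ge0; exact: ltW.
have w0 : 0 <= l ^+ 3 * sigma ^+ 3 by apply: mulr_ge0; apply: exprn_ge0; exact: ltW.
by rewrite /D lerDr; apply: addr_ge0 => //; exact: addr_ge0.
Qed.

Lemma grad_average_le :
  K%:R^-1 * \sum_(j < K) (25 / 12 / Num.sqrt eta ^+ 3 * r j + 5 / 3 * delta `^ (3 / 2)
               + 5 / 6 * Num.sqrt eta ^+ 3 * v j) <= 225 * D / q ^+ 9.
Proof.
have [XD TD] := sums_bounds.
rewrite !big_split/= -!mulr_sumr sumr_const card_ord -/S -/V.
rewrite ler_pdivlMr ?exprn_gt0//.
apply: (le_trans _ (@grad_rate _ _ _ _ _ c0 c2 D1 X0 T0 XD TD)).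
rewrite -(mulr_natr (delta `^ _)) q10 sqrt_eta delta_powR; apply: le_of_eq.
(* The relation [c^2 = 17] is unknown to [field], so the factors equal to 1 by it are displayed and
   removed afterwards. *)
transitivity (25 / 12 * c * (c ^+ 2 / 17) * X + 5 / (51 * c)
   + 5 / 6 * c * (17 / c ^+ 2) ^+ 2 * T).
  by rewrite /X /T /eta; field; rewrite qn0 cn0.
by rewrite c2 divff ?expr1n ?mulr1// pnatr_eq0.
Qed.

Lemma hess_average_le :
  K%:R^-1 * \sum_(j < K) (4 / eta ^+ 3 * r j + 4 * v j) <= 21075 * D / q ^+ 6.
Proof.
have [XD TD] := sums_bounds.
rewrite !big_split/= -!mulr_sumr -/S -/V.
rewrite ler_pdivlMr ?exprn_gt0//.
have -> : K%:R^-1 * (4 / eta ^+ 3 * S + 4 * V) * q ^+ 6 = 1156 * (X + T).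
  by rewrite q10 /X /T /eta; field.
exact: hess_rate.
Qed.

End Schedule.

(** The exponents 3/5 and 3/2 undo 5/3 and 2/3, and [10 * (3/5) * (3/2) = 9]. *)
Lemma grad_threshold {R : realType} (A eps q : R) : 0 <= A -> 0 < eps -> 0 < q ->
  (A `^ (2 / 3) / eps) `^ (5 / 3) <= q ^+ 10 -> A <= eps `^ (3 / 2) * q ^+ 9.
Proof.
move=> A0 eps0 q0 h.
have Y0 : 0 <= A `^ (2 / 3) / eps by rewrite divr_ge0 ?powR_ge0// ltW.
have q60 : 0 <= q ^+ 6 by rewrite exprn_ge0// ltW.
have h1 : A `^ (2 / 3) / eps <= q ^+ 6.
  have : ((A `^ (2 / 3) / eps) `^ (5 / 3)) `^ (3 / 5) <= (q ^+ 10) `^ (3 / 5).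
    apply: ge0_ler_powR => //; rewrite ?nnegrE ?powR_ge0//.
    exact/exprn_ge0/ltW.
  rewrite -powRrM (_ : 5 / 3 * (3 / 5) = 1); last by field.
  rewrite powRr1// -powR_mulrn ?(ltW q0)// -powRrM (_ : 10%:R * (3 / 5) = 6%:R); last by field.
  by rewrite powR_mulrn// ltW.
have : (A `^ (2 / 3)) `^ (3 / 2) <= (q ^+ 6 * eps) `^ (3 / 2).
  apply: ge0_ler_powR; rewrite ?nnegrE ?powR_ge0//.
  - by rewrite mulr_ge0// ltW.
  - by rewrite -ler_pdivrMr.
rewrite -powRrM (_ : 2 / 3 * (3 / 2) = 1); last by field.
rewrite powRr1// powRM// ?(ltW eps0)// mulrC => /le_trans; apply.
rewrite -powR_mulrn ?(ltW q0)// -powRrM (_ : 6%:R * (3 / 2) = 9%:R); last by field.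
by rewrite powR_mulrn// ltW.
Qed.

Lemma hess_threshold {R : realType} (A eps q : R) : 0 <= A -> 0 < eps -> 0 < q ->
  (A `^ (1 / 3) / eps) ^+ 5 <= q ^+ 10 -> A <= eps ^+ 3 * q ^+ 6.
Proof.
move=> A0 eps0 q0 h.
have h1 : A `^ (1 / 3) / eps <= q ^+ 2.
  rewrite -(@ler_pXn2r _ 5) ?nnegrE ?sqr_ge0//; first by rewrite -exprM.
  by rewrite divr_ge0 ?powR_ge0// ltW.
rewrite ler_pdivrMr// in h1.
have : (A `^ (1 / 3)) ^+ 3 <= (q ^+ 2 * eps) ^+ 3.
  by rewrite ler_pXn2r// nnegrE ?powR_ge0// mulr_ge0 ?sqr_ge0// ltW.
rewrite -powR_mulrn ?powR_ge0// -powRrM (_ : 1 / 3 * 3%:R = 1); last by field.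
by rewrite powRr1// exprMn -exprM mulrC.
Qed.

Theorem theorem2 (R : realType) (n : nat) (n_gt0 : (0 < n)%N)
    (dZ dXi dO : measure_display)
    (Z : measurableType dZ) (Xi : measurableType dXi)
    (Omega : measurableType dO)
    (PZ : probability Z R) (PXi : probability Xi R) (P : probability Omega R)
    (f : 'cV[R]_n -> R)
    (G : R -> 'cV[R]_n -> Z -> 'cV[R]_n) (H : 'cV[R]_n -> Xi -> 'M[R]_n)
    (f_low L L_F sigma L_H : R)
    (f_C2 : twice_cont_diff f)
    (f_min : exists xopt, forall x, f xopt <= f x)
    (hA : assumptionA PZ PXi f G H f_low L L_F sigma)
    (hB : assumptionB PXi H L_H)
    (x0 : 'cV[R]_n) (K : nat) (K_gt0 : (0 < K)%N)
    (zeta : nat -> {RV P >-> Z}) (xi : nat -> {RV P >-> Xi})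
    (x : nat -> {RV P >-> 'cV[R]_n})
    (hx : scrn_rm PZ PXi G H x0
            (fun=> 1 / (17 * K%:R `^ (1 / 5)))
            (fun=> 1 / (17 * K%:R `^ (3 / 5)))
            (fun=> 625 * (L_F ^+ 3 + L_H ^+ 3) `^ (2 / 3)
                   / (289 * K%:R `^ (2 / 5)))
            zeta xi x)
    (iotaK : {RV P >-> nat})
    (iotaK_unif : uniform_index P K iotaK)
    (iotaK_indep : independent_of P (full_history x zeta xi) iotaK)
    (eps_g eps_H : R) (heps_g : 0 < eps_g < 1) (heps_H : 0 < eps_H < 1)
    (hK : Num.max (((3 * M_rm (f x0) f_low L_F L_H sigma) `^ (2 / 3) / eps_g)
                     `^ (5 / 3))
         (Num.max (((281 * M_rm (f x0) f_low L_F L_H sigma) `^ (1 / 3) / eps_H)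
                     ^+ 5)
         (Num.max ((2 * L / 17) ^+ 5)
         (Num.max (7 * (L_F ^+ 3 + L_H ^+ 3) `^ (5 / 3)) 1)))
          <= K%:R) :
  stochastic_sosp P f eps_g eps_H (fun w => x (iotaK w) w).
Proof.
have L0 := A_L_gt0 hA; have LF0 := A_L_F_gt0 hA; have LH0 := B_L_H_gt0 hB.
have s0 := A_sigma_gt0 hA.
have [/andP[eg0 eg1] /andP[eH0 eH1]] := (heps_g, heps_H).
have KR0 : 0 <= K%:R :> R by exact: ler0n.
(* A tenth root, because [sqrt eta] is of order [K^(-1/10)]. *)
pose q : R := K%:R `^ 10%:R^-1.
have q0 : 0 < q by rewrite powR_gt0// ltr0n.
have q10 : K%:R = q ^+ 10 by rewrite -powR_natdiv// divff ?powRr1// pnatr_eq0.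
have e15 : K%:R `^ (1 / 5) = q ^+ 2 by rewrite -powR_natdiv//; congr (_ `^ _); field.
have e25 : K%:R `^ (2 / 5) = q ^+ 4 by rewrite -powR_natdiv//; congr (_ `^ _); field.
have e35 : K%:R `^ (3 / 5) = q ^+ 6 by rewrite -powR_natdiv//; congr (_ `^ _); field.
set Lam := L_F ^+ 3 + L_H ^+ 3 in hx hK *.
have Lam0 : 0 < Lam by rewrite addr_gt0// exprn_gt0.
pose l : R := Lam `^ 3%:R^-1.
have l0 : 0 < l by rewrite powR_gt0.
have l3 : Lam = l ^+ 3 by rewrite -powR_natdiv ?(ltW Lam0)// divff ?powRr1 ?(ltW Lam0)// pnatr_eq0.
have l2 : Lam `^ (2 / 3) = l ^+ 2 by rewrite -powR_natdiv ?(ltW Lam0).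
have l5 : Lam `^ (5 / 3) = l ^+ 5 by rewrite -powR_natdiv ?(ltW Lam0).
rewrite l5 in hK; rewrite e15 e25 e35 l2 in hx.
pose c : R := Num.sqrt 17.
have c0 : 0 < c by rewrite sqrtr_gt0.
have c2 : c ^+ 2 = 17 by rewrite sqr_sqrtr.
set F0 := f x0 - f_low.
have F00 : 0 <= F0 by rewrite subr_ge0; exact: (A_lower_bound hA).
pose D := F0 + sigma ^+ 3 / l ^+ 2 + l ^+ 3 * sigma ^+ 3 + 1.
have ME : M_rm (f x0) f_low L_F L_H sigma = 75 * D.
  by rewrite /M_rm -/Lam -/F0 powRN l2 /D -l3.
rewrite ME in hK.
have D1 : 1 <= D.
  have u0 : 0 <= sigma ^+ 3 / l ^+ 2 by rewrite divr_ge0 ?exprn_ge0 ?(ltW s0) ?(ltW l0).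
  have w0 : 0 <= l ^+ 3 * sigma ^+ 3 by rewrite mulr_ge0 ?exprn_ge0 ?(ltW s0) ?(ltW l0).
  by rewrite /D lerDr; apply: addr_ge0 => //; exact: addr_ge0.
move: hK; rewrite !ge_max => /andP[k1 /andP[k2 /andP[k3 /andP[k4 k5]]]].
rewrite q10 in k1 k2 k3 k4 k5.
have q1 : 1 <= q by rewrite -(@ler_pXn2r _ 10) ?nnegrE ?(ltW q0)// expr1n.
set eta := 1 / (17 * q ^+ 2) in hx.
set delta := 1 / (17 * q ^+ 6) in hx.
set theta := 625 * l ^+ 2 / (289 * q ^+ 4) in hx.
have delta01 : 0 < delta < 1 by rewrite delta_gt0// delta_lt1.
have theta01 : 0 < theta < 1 by rewrite theta_gt0// theta_lt1.
have [a [v [r [a0 v0 avr rec [hg hh]]]]] := output_moments f_C2 hA hB (eta_gt0 q0)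
  (L_eta_le1 q0 L0 k3) delta01 theta01 hx K_gt0 iotaK_unif iotaK_indep.
rewrite -/Lam l3 in rec.
have D0 : 0 <= D by exact: le_trans D1.
split.
  apply: le_trans hg _; rewrite lee_fin.
  apply: le_trans (grad_average_le q0 l0 c0 c2 s0 F00 a0 v0 avr rec q10) _.
  rewrite ler_pdivrMr ?exprn_gt0//.
  have -> : 225 * D = 3 * (75 * D) by ring.
  by apply: grad_threshold => //; rewrite !mulr_ge0.
apply: le_trans hh; rewrite lee_fin lerN2.
apply: le_trans (hess_average_le q0 l0 c0 c2 s0 F00 a0 v0 avr rec q10) _.
rewrite ler_pdivrMr ?exprn_gt0//.
have -> : 21075 * D = 281 * (75 * D) by ring.
by apply: hess_threshold => //; rewrite !mulr_ge0.
Qed.
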